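(* Let $\mathcal{C}$ be a fusion category over a field $\Bbbk$ and let $\mathcal{D},\mathcal{E}\subset\mathcal{C}$ be two fusion subcategories. Let $T$ be the linear operator on $K_0(\mathcal{C})_{\mathbb{C}}$ defined by $T\,x=\mathrm{R}_{\mathcal{D}}\,x\,\mathrm{R}_{\mathcal{E}}$. For each $\mathcal{D}$-$\mathcal{E}$ double coset $B\subset\Lambda_{\mathcal{C}}$, the space $K_0(B)_{\mathbb{C}}=\bigoplus_{X\in B}\mathbb{C}[X]$ is stable under $T$. Denoting by $T_B$ the restriction of $T$ to $K_0(B)_{\mathbb{C}}$, the matrix of $T_B$ in the basis $B$ has real non-negative entries and is indecomposable. Its Frobenius-Perron eigenvalue is $\mathrm{FPdim}(\mathcal{D})\,\mathrm{FPdim}(\mathcal{E})$, and the corresponding eigenspace is the line generated by $\mathrm{R}_B=\sum_{X\in B}\mathrm{FPdim}(X)[X]$.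
   Context: A fusion category over a field $\Bbbk$ is a $\Bbbk$-linear semisimple rigid monoidal category with finitely many isomorphism classes of simple objects, finite dimensional Hom spaces, such that $\mathrm{End}(S)=\Bbbk$ for every simple object $S$, and whose unit object $\mathbf{1}$ is simple. A fusion subcategory is a full replete monoidal subcategory which is itself a fusion category. $\Lambda_{\mathcal{C}}$ is the set of isomorphism classes of simple objects of $\mathcal{C}$. $K_0(\mathcal{C})=\bigoplus_{X\in\Lambda_{\mathcal{C}}}\mathbb{Z}[X]$ is the Grothendieck ring (product induced by $\otimes$), and $K_0(\mathcal{C})_{\mathbb{C}}=K_0(\mathcal{C})\otimes_{\mathbb{Z}}\mathbb{C}$. For a fusion subcategory $\mathcal{D}$ one views $K_0(\mathcal{D})_{\mathbb{C}}\subset K_0(\mathcal{C})_{\mathbb{C}}$. For simple $X$, $\mathrm{FPdim}(X)>0$ is the Frobenius-Perron eigenvalue of left multiplication by $[X]$ on $K_0(\mathcal{C})$; it extends linearly to an algebra morphism $K_0(\mathcal{C})_{\mathbb{C}}\to\mathbb{C}$. The regular virtual object of $\mathcal{C}$ is $\mathrm{R}_{\mathcal{C}}=\sum_{X\in\Lambda_{\mathcal{C}}}\mathrm{FPdim}(X)[X]$, and $\mathrm{FPdim}(\mathcal{C})=\mathrm{FPdim}(\mathrm{R}_{\mathcal{C}})=\sum_{X\in\Lambda_{\mathcal{C}}}\mathrm{FPdim}(X)^2$; likewise for $\mathcal{D}$ and $\mathcal{E}$. $\mathcal{D}$-$\mathcal{E}$ double cosets are the classes of the equivalence relation on $\Lambda_{\mathcal{C}}$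 given by: $X\sim Y$ iff there exist $D\in\Lambda_{\mathcal{D}}$, $E\in\Lambda_{\mathcal{E}}$ such that $Y$ is a factor (direct summand) of $D\otimes X\otimes E$. A matrix $A=(a_{uv})\in M_n(\mathbb{C})$ is indecomposable if $\{1,\dots,n\}$ cannot be written as a disjoint union $J_1\cup J_2$ with $J_1\neq\emptyset$, $J_2\neq\emptyset$, in such a way that $a_{uv}=0$ whenever $u\in J_1$ and $v\in J_2$. The Frobenius-Perron eigenvalue of an indecomposable matrix with real non-negative entries is its spectral radius, which is an eigenvalue by the Frobenius-Perron theorem. *)

(* Defs.v *)
From HB Require Import structures.
From mathcomp Require Import all_boot all_order all_algebra.
From mathcomp Require Import finmap.
From mathcomp Require Import boolp classical_sets functions cardinality reals.
From mathcomp Require Import complex.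
Set Implicit Arguments.
Unset Strict Implicit.
Unset Printing Implicit Defensive.
Import Order.TTheory GRing.Theory Num.Theory.
Local Open Scope ring_scope.

(** * Linear monoidal categories *)

(* Hom spaces are finite dimensional because they are [vectType]s. *)
Record linCat (k : fieldType) := LinCat {
  Ob :> Type;
  Hom : Ob -> Ob -> vectType k;
  idm : forall X, Hom X X;
  comp : forall X Y Z, Hom Y Z -> Hom X Y -> Hom X Z;
  compA : forall X Y Z W (h : Hom Z W) (g : Hom Y Z) (f : Hom X Y),
    comp h (comp g f) = comp (comp h g) f;
  comp1m : forall X Y (f : Hom X Y), comp (idm Y) f = f;
  compm1 : forall X Y (f : Hom X Y), comp f (idm X) = f;
  comp_linearl : forall X Y Z (a : k) (g g' : Hom Y Z) (f : Hom X Y),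
    comp (a *: g + g') f = a *: comp g f + comp g' f;
  comp_linearr : forall X Y Z (a : k) (g : Hom Y Z) (f f' : Hom X Y),
    comp g (a *: f + f') = a *: comp g f + comp g f'
}.
Arguments idm {k l} X : rename.
Arguments comp {k l X Y Z} g f : rename.

Declare Scope cat_scope.
Delimit Scope cat_scope with cat.
Notation "g ∘ f" := (comp g f) (at level 40, left associativity) : cat_scope.
Local Open Scope cat_scope.

Definition inverse_pair (k : fieldType) (C : linCat k) (X Y : C)
    (f : Hom X Y) (g : Hom Y X) : Prop :=
  g ∘ f = idm X /\ f ∘ g = idm Y.

Record linMonCat (k : fieldType) := LinMonCat {
  lcat :> linCat k;
  unitOb : lcat;
  tens : lcat -> lcat -> lcat;
  tensm : forall X X' Y Y' : lcat,
    Hom X X' -> Hom Y Y' -> Hom (tens X Y) (tens X' Y');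
  tensm1 : forall X Y : lcat, tensm (idm X) (idm Y) = idm (tens X Y);
  tensm_comp : forall (X X' X'' Y Y' Y'' : lcat) (f' : Hom X' X'')
      (f : Hom X X') (g' : Hom Y' Y'') (g : Hom Y Y'),
    tensm (f' ∘ f) (g' ∘ g) = tensm f' g' ∘ tensm f g;
  tensm_linearl : forall (X X' Y Y' : lcat) (a : k) (f f' : Hom X X')
      (g : Hom Y Y'),
    tensm (a *: f + f') g = a *: tensm f g + tensm f' g;
  tensm_linearr : forall (X X' Y Y' : lcat) (a : k) (f : Hom X X')
      (g g' : Hom Y Y'),
    tensm f (a *: g + g') = a *: tensm f g + tensm f g';
  assoc : forall X Y Z : lcat,
    Hom (tens (tens X Y) Z) (tens X (tens Y Z));
  assocV : forall X Y Z : lcat,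
    Hom (tens X (tens Y Z)) (tens (tens X Y) Z);
  assocK : forall X Y Z : lcat, inverse_pair (assoc X Y Z) (assocV X Y Z);
  assoc_nat : forall (X X' Y Y' Z Z' : lcat) (f : Hom X X') (g : Hom Y Y')
      (h : Hom Z Z'),
    assoc X' Y' Z' ∘ tensm (tensm f g) h
    = tensm f (tensm g h) ∘ assoc X Y Z;
  lunit : forall X : lcat, Hom (tens unitOb X) X;
  lunitV : forall X : lcat, Hom X (tens unitOb X);
  lunitK : forall X : lcat, inverse_pair (lunit X) (lunitV X);
  lunit_nat : forall (X X' : lcat) (f : Hom X X'),
    lunit X' ∘ tensm (idm unitOb) f = f ∘ lunit X;
  runit : forall X : lcat, Hom (tens X unitOb) X;
  runitV : forall X : lcat, Hom X (tens X unitOb);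
  runitK : forall X : lcat, inverse_pair (runit X) (runitV X);
  runit_nat : forall (X X' : lcat) (f : Hom X X'),
    runit X' ∘ tensm f (idm unitOb) = f ∘ runit X;
  pentagon : forall X Y Z W : lcat,
    assoc X Y (tens Z W) ∘ assoc (tens X Y) Z W
    = tensm (idm X) (assoc Y Z W) ∘ assoc X (tens Y Z) W
      ∘ tensm (assoc X Y Z) (idm W);
  triangle : forall X Y : lcat,
    tensm (idm X) (lunit Y) ∘ assoc X unitOb Y = tensm (runit X) (idm Y)
}.
Arguments unitOb {k} l.
Notation "X ⊗ Y" := (tens X Y) (at level 40, left associativity) : cat_scope.
Notation "f ⊠ g" := (tensm f g) (at level 40, left associativity) : cat_scope.

(** * Abelian and semisimple categories *)

Section LinCatTheory.
Variables (k : fieldType) (C : linCat k).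
Implicit Types X Y Z W K S : C.

Definition is_iso X Y (f : Hom X Y) : Prop := exists g, inverse_pair f g.
Definition isomorphic X Y : Prop := exists f : Hom X Y, is_iso f.

Definition mono X Y (f : Hom X Y) : Prop :=
  forall Z (g h : Hom Z X), f ∘ g = f ∘ h -> g = h.
Definition epi X Y (f : Hom X Y) : Prop :=
  forall Z (g h : Hom Y Z), g ∘ f = h ∘ f -> g = h.

Definition is_kernel X Y (f : Hom X Y) K (i : Hom K X) : Prop :=
  f ∘ i = 0 /\
  forall Z (g : Hom Z X), f ∘ g = 0 -> exists! h : Hom Z K, i ∘ h = g.
Definition is_cokernel X Y (f : Hom X Y) K (p : Hom Y K) : Prop :=
  p ∘ f = 0 /\
  forall Z (g : Hom Y Z), g ∘ f = 0 -> exists! h : Hom K Z, h ∘ p = g.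

(* For empty [I] this says that [idm W = 0], i.e. that [W] is a zero object. *)
Definition is_direct_sum (I : finType) (F : I -> C) W : Prop :=
  exists (i : forall j, Hom (F j) W) (p : forall j, Hom W (F j)),
    [/\ forall j, p j ∘ i j = idm (F j),
        forall j l, j != l -> p l ∘ i j = 0
      & \sum_j (i j ∘ p j) = idm W].

Definition is_abelian : Prop :=
  [/\ forall n (F : 'I_n -> C), exists W, is_direct_sum F W,
      forall X Y (f : Hom X Y), exists K (i : Hom K X), is_kernel f i,
      forall X Y (f : Hom X Y), exists K (p : Hom Y K), is_cokernel f p,
      forall X Y (f : Hom X Y), mono f ->
        exists Z (g : Hom Y Z), is_kernel g f
    & forall X Y (f : Hom X Y), epi f ->
        exists Z (g : Hom Z X), is_cokernel g f].

Definition is_zero X : Prop := idm X = 0.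

Definition is_simple S : Prop :=
  ~ is_zero S /\
  forall X (f : Hom X S), mono f -> is_zero X \/ is_iso f.

Definition is_semisimple : Prop :=
  is_abelian /\
  forall X, exists n (F : 'I_n -> C),
    (forall j, is_simple (F j)) /\ is_direct_sum F X.

Definition is_summand Y W : Prop :=
  exists Z, is_direct_sum (fun b : bool => if b then Y else Z) W.

Definition iso_class X : set C := [set Y | isomorphic X Y].
Definition simple_classes : set (set C) := iso_class @` [set S | is_simple S].

End LinCatTheory.
Arguments simple_classes {k} C.

(** * Fusion categories *)

Section Fusion.
Variables (k : fieldType) (C : linMonCat k).
Implicit Types X Y : C.

(* [Y] is a left dual of [X], and [X] is a right dual of [Y]. *)
Definition is_dual_pair Y X : Prop :=
  exists (ev : Hom (Y ⊗ X) (unitOb C)) (coev : Hom (unitOb C) (X ⊗ Y)),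
    runit X ∘ (idm X ⊠ ev) ∘ assoc X Y X ∘ (coev ⊠ idm X) ∘ lunitV X = idm X
    /\
    lunit Y ∘ (ev ⊠ idm Y) ∘ assocV Y X Y ∘ (idm Y ⊠ coev) ∘ runitV Y = idm Y.

Definition is_rigid : Prop :=
  forall X, (exists Y, is_dual_pair Y X) /\ (exists Y, is_dual_pair X Y).

Definition is_fusion : Prop :=
  [/\ is_semisimple C, is_rigid,
      finite_set (simple_classes C),
      forall (S : C), is_simple S ->
        forall f : Hom S S, exists! a : k, f = a *: idm S
    & is_simple (unitOb C)].

End Fusion.

(** * Fusion subcategories *)

Section FullSubcategory.
Variables (k : fieldType) (C : linMonCat k) (P : C -> Prop).

Definition full_linCat : linCat k :=
  @LinCat k {X : C | P X} (fun X Y => Hom (sval X) (sval Y))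
    (fun X => idm (sval X)) (fun X Y Z g f => comp g f)
    (fun X Y Z W h g f => compA h g f)
    (fun X Y f => comp1m f) (fun X Y f => compm1 f)
    (fun X Y Z a g g' f => comp_linearl a g g' f)
    (fun X Y Z a g f f' => comp_linearr a g f f').

Hypothesis P1 : P (unitOb C).
Hypothesis PM : forall X Y, P X -> P Y -> P (X ⊗ Y).

Definition full_linMonCat : linMonCat k :=
  @LinMonCat k full_linCat (exist P (unitOb C) P1)
    (fun X Y => exist P (sval X ⊗ sval Y) (PM (svalP X) (svalP Y)))
    (fun X X' Y Y' f g => @tensm k C (sval X) (sval X') (sval Y) (sval Y') f g)
    (fun X Y => tensm1 (sval X) (sval Y))
    (fun X X' X'' Y Y' Y'' f' f g' g => tensm_comp f' f g' g)
    (fun X X' Y Y' a f f' g => tensm_linearl a f f' g)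
    (fun X X' Y Y' a f g g' => tensm_linearr a f g g')
    (fun X Y Z => assoc (sval X) (sval Y) (sval Z))
    (fun X Y Z => assocV (sval X) (sval Y) (sval Z))
    (fun X Y Z => assocK (sval X) (sval Y) (sval Z))
    (fun X X' Y Y' Z Z' f g h => assoc_nat f g h)
    (fun X => lunit (sval X)) (fun X => lunitV (sval X))
    (fun X => lunitK (sval X)) (fun X X' f => lunit_nat f)
    (fun X => runit (sval X)) (fun X => runitV (sval X))
    (fun X => runitK (sval X)) (fun X X' f => runit_nat f)
    (fun X Y Z W => pentagon (sval X) (sval Y) (sval Z) (sval W))
    (fun X Y => triangle (sval X) (sval Y)).

End FullSubcategory.

Record fusionSubcat (k : fieldType) (C : linMonCat k) := FusionSubcat {
  sub_pred : C -> Prop;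
  sub_replete : forall X Y, isomorphic X Y -> sub_pred X -> sub_pred Y;
  sub_unit : sub_pred (unitOb C);
  sub_tens : forall X Y, sub_pred X -> sub_pred Y -> sub_pred (X ⊗ Y);
  sub_fusion : is_fusion (full_linMonCat sub_unit sub_tens)
}.

Definition sub_cat (k : fieldType) (C : linMonCat k) (D : fusionSubcat C) :
  linMonCat k := full_linMonCat (@sub_unit k C D) (@sub_tens k C D).
Coercion sub_cat : fusionSubcat >-> linMonCat.

(** * Frobenius-Perron theory of complex matrices *)

Definition spectral_radius (R : realType) n (A : 'M[R[i]]_n) : R :=
  sup [set complex.Re `|z| | z in [set z : R[i] | eigenvalue A z]].

Definition indecomposable (R : realType) n (A : 'M[R[i]]_n) : Prop :=
  ~ exists J1 J2 : {set 'I_n},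
      [/\ J1 :|: J2 = [set: 'I_n]%SET, [disjoint J1 & J2],
          J1 != finset.set0, J2 != finset.set0
        & forall u v, u \in J1 -> v \in J2 -> A u v = 0].

(** * The Grothendieck ring *)

Section Grothendieck.
Variables (k : fieldType) (C : linMonCat k) (R : realType).

(* The isomorphism classes of simple objects.  When [A] is finite, [fset_set A]
   has the same elements as [A]. *)
Definition Lambda : finType := fset_set (simple_classes C).

(* A chosen object of the class [X]; the default [unitOb C] is irrelevant,
   since isomorphism classes are nonempty. *)
Definition repr (X : Lambda) : C :=
  if pselect (exists Z, fsval X Z) is left exZ then sval (cid exZ)
  else unitOb C.

(* The complexified Grothendieck ring; [x X] is the coefficient of [X] in
   [x]. *)
Definition K0 : Type := {ffun Lambda -> R[i]^o}.

Definition K0basis (X : Lambda) : K0 := [ffun Y => (Y == X)%:R].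

(* The class of an object: since endomorphisms of simple objects are scalar,
   the multiplicity of [Z] in [W] is [dim Hom(Z, W)]. *)
Definition K0class (W : C) : K0 :=
  [ffun Z => (\dim {: Hom (repr Z) W})%:R].

Definition K0mul (x y : K0) : K0 :=
  \sum_X \sum_Y (x X * y Y) *: K0class (repr X ⊗ repr Y).

Definition K0span (B : {set Lambda}) : {vspace K0} :=
  <<[seq K0basis X | X in B]>>%VS.

(* The matrix in the basis [B] of an operator [f] that preserves [K0span B];
   column [j] holds the coordinates of [f] applied to the [j]-th element. *)
Definition op_matrix (B : {set Lambda}) (f : K0 -> K0) : 'M[R[i]]_#|B| :=
  \matrix_(i, j) f (K0basis (enum_val j)) (enum_val i).

Definition FPdim (X : Lambda) : R :=
  spectral_radius (op_matrix [set: Lambda]%SET (K0mul (K0basis X))).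

(* The virtual object [R_B]; the regular one is the case where [B] is full. *)
Definition regular_on (B : {set Lambda}) : K0 :=
  \sum_(X in B) (FPdim X)%:C%C *: K0basis X.

Definition regular : K0 := regular_on [set: Lambda]%SET.

Definition FPdim_cat : R := \sum_(X : Lambda) FPdim X ^+ 2.

End Grothendieck.
Arguments regular {k} C R.
Arguments FPdim_cat {k} C R.

Section DoubleCosets.
Variables (k : fieldType) (C : linMonCat k) (R : realType).

Definition sub_incl (D : fusionSubcat C) : sub_cat D -> C := sval.

Definition K0incl (D : fusionSubcat C) (x : K0 D R) : K0 C R :=
  \sum_X x X *: K0class R (sub_incl (repr X)).

Variables D E : fusionSubcat C.

Definition double_coset_rel (X Y : Lambda C) : Prop :=
  exists (d : Lambda D) (e : Lambda E),
    is_summand (repr Y) (sub_incl (repr d) ⊗ repr X ⊗ sub_incl (repr e)).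

Definition is_double_coset (B : {set Lambda C}) : Prop :=
  exists X, forall Y, Y \in B <-> double_coset_rel X Y.

Definition double_op (x : K0 C R) : K0 C R :=
  K0mul (K0mul (K0incl (regular D R)) x) (K0incl (regular E R)).

End DoubleCosets.

(* Main.v *)
Require Import Defs.
From mathcomp Require Import all_boot all_order all_algebra.
From mathcomp Require Import boolp classical_sets reals complex.
From HB Require Import structures.
From mathcomp Require Import finmap functions cardinality spectral.
Import Defs Order.TTheory GRing.Theory Num.Theory.
Local Open Scope ring_scope.
Set Implicit Arguments.
Unset Strict Implicit.
Unset Printing Implicit Defensive.

(** The Grothendieck ring of a fusion category is a based ring: semisimplicity
    and Schur's lemma make [dim Hom(V, W)] the scalar product of the
    multiplicities of [V] and [W], and duals give an involution [X |-> X^*] of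
    the basis with [N_{X^* A}^B = N_{X B}^A].  Frobenius-Perron theory for the
    positive symmetric matrix of multiplication by the sum of the basis shows
    that [FPdim] is the unique positive character; hence it is compatible with
    the inclusions of [D] and [E], and [R_D R_D = FPdim(D) R_D].

    Consequently the matrix of [T] on the whole basis is non-negative, symmetric
    (because [R_D] and [R_E] are invariant under duality), satisfies
    [T^2 = FPdim(D) FPdim(E) T], and admits [R_C] as a positive eigenvector.
    Its entry at [(Y, X)] is positive if and only if [X ~ Y], so [~] is an
    equivalence relation and the block of a double coset is strictly positive.
    Indecomposability is then immediate, and the eigenspace is a line by the
    maximum principle. *)

(** * Positive matrices *)

Section PositiveMatrices.
Local Open Scope sesquilinear_scope.
Variable K : numClosedFieldType.

Definition sqnorm n (w : 'rV[K]_n) : K := \sum_i `|w 0 i| ^+ 2.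

Lemma sqnormE n (w : 'rV[K]_n) : sqnorm w = (w *m w^t*) 0 0.
Proof. by rewrite mxE; apply: eq_bigr => i _; rewrite !mxE normCK. Qed.

Lemma sqnorm_unitary n (w : 'rV[K]_n) (P : 'M[K]_n) :
  P \is unitarymx -> sqnorm (w *m P) = sqnorm w.
Proof.
move=> Pu; rewrite !sqnormE trmx_mul map_mxM mulmxA.
by rewrite (mulmxtVK _ Pu).
Qed.

(** A real symmetric matrix is normal, hence diagonalised by a unitary [P]. The row of [P] at a
    diagonal entry of largest modulus is the eigenvector, and the norm bound is checked
    coordinatewise in the eigenbasis. *)
Lemma symmetric_dominant_eigenvector n (A : 'M[K]_n.+1) :
  (forall i j, A i j \is Num.real) -> A^T = A ->
  exists (z : 'rV[K]_n.+1) (d : K),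
    [/\ z != 0, z *m A = d *: z
      & forall w, sqnorm (w *m A) <= `|d| ^+ 2 * sqnorm w].
Proof.
move=> Areal Asym.
have Aadj : A^t* = A.
  by rewrite Asym; apply/matrixP=> i j; rewrite !mxE; exact: (CrealP (Areal _ _)).
have Anormal : A \is normalmx by apply/normalmxP; rewrite Aadj.
have Pu := spectral_unitarymx A.
have /orthomx_spectralP := Anormal.
rewrite invmx_unitary //.
set P := spectralmx A in Pu *; set sp := spectral_diag A => AE.
have real_sp : {in xpredT, forall i, `|sp 0 i| \is Num.real}.
  by move=> i _; exact: normr_real.
have [i0 _ spmax] := real_arg_maxP (isT : xpredT (ord0 : 'I_n.+1)) real_sp.
exists (row i0 P), (sp 0 i0); split.
- apply/eqP => z0; have := unitarymxP Pu => /(congr1 (row i0)).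
  rewrite row_mul z0 mul0mx => /rowP/(_ i0).
  by rewrite !mxE eqxx => /eqP; rewrite eq_sym oner_eq0.
- rewrite {1}AE !mulmxA -row_mul (unitarymxP Pu) row1 -rowE.
  by rewrite row_diag_mx -scalemxAl -rowE.
move=> w; rewrite {1}AE mulmxA sqnorm_unitary // mulmxA.
rewrite -[sqnorm w](sqnorm_unitary w (P := P^t*)); last first.
  by rewrite trmxC_unitary.
set y := w *m _; rewrite /sqnorm mulr_sumr; apply: ler_sum => j _.
rewrite mul_mx_diag mxE normrM exprMn mulrC ler_wpM2r ?exprn_ge0 //.
by rewrite ler_sqr ?nnegrE //; apply: spmax.
Qed.

(* The entrywise modulus [w] of a dominant eigenvector [z] satisfies
   [|d| w <= w A] entrywise and [|w A| <= |d| |w|], so [w A = |d| w]. *)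
Lemma positive_symmetric_eigenvector (I : finType) (i0 : I) (A : I -> I -> K) :
  (forall i j, 0 < A i j) -> (forall i j, A i j = A j i) ->
  exists (v : I -> K) (rho : K),
    (forall i, 0 < v i) /\ forall j, \sum_i v i * A i j = rho * v j.
Proof.
move=> Apos Asym.
have [n cardI] : exists n, #|I| = n.+1.
  have /card_gt0P : exists i, i \in I by exists i0.
  by case: #|I| => // n _; exists n.
pose e : 'I_n.+1 -> I := fun i => enum_val (cast_ord (esym cardI) i).
pose e' : I -> 'I_n.+1 := fun i => cast_ord cardI (enum_rank i).
have eK : cancel e e' by move=> i; rewrite /e /e' enum_valK cast_ordKV.
have e'K : cancel e' e by move=> i; rewrite /e /e' cast_ordK enum_rankK.
pose M : 'M[K]_n.+1 := \matrix_(i, j) A (e i) (e j).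
have [||z [d [z0 zA dom]]] := @symmetric_dominant_eigenvector n M.
- by move=> i j; rewrite mxE gtr0_real.
- by apply/matrixP => i j; rewrite !mxE.
pose w : 'rV[K]_n.+1 := map_mx Num.norm z.
have w_ge0 i : 0 <= w 0 i by rewrite mxE.
have wM j : `|d| * w 0 j <= (w *m M) 0 j.
  rewrite !mxE -normrM; have /rowP/(_ j) := zA; rewrite !mxE => <-.
  apply: le_trans (ler_norm_sum _ _ _) _; apply: ler_sum => i _.
  by rewrite normrM !mxE (gtr0_norm (Apos _ _)).
have wM_eq j : (w *m M) 0 j = `|d| * w 0 j.
  apply/eqP; rewrite -subr_eq0.
  have wM_ge0 i : 0 <= (w *m M) 0 i.
    by apply: le_trans (wM i); rewrite mulr_ge0.
  have sq_ge0 i : true -> 0 <= `|(w *m M) 0 i| ^+ 2 - `|d| ^+ 2 * `|w 0 i| ^+ 2.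
    move=> _; rewrite subr_ge0 -exprMn ler_sqr ?nnegrE ?mulr_ge0 //.
    by rewrite (ger0_norm (w_ge0 i)) (ger0_norm (wM_ge0 i)).
  (* Each term is non-negative by [wM], while [dom] bounds the whole sum above by 0, so every term
     vanishes. *)
  have : \sum_i (`|(w *m M) 0 i| ^+ 2 - `|d| ^+ 2 * `|w 0 i| ^+ 2) == 0.
    rewrite eq_le sumr_ge0 // andbT sumrB subr_le0 -mulr_sumr; exact: dom.
  rewrite psumr_eq0 // => /allP/(_ j); rewrite mem_index_enum => /(_ isT) /=.
  rewrite subr_eq0 -exprMn (ger0_norm (w_ge0 j)) (ger0_norm (wM_ge0 j)).
  rewrite subr_eq0 => /eqP/(@pexpIrn _ 2 isT) -> //;
    by rewrite nnegrE ?mulr_ge0.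
have [i1 wi1] : exists i, 0 < w 0 i.
  have /rV0Pn[i zi] := z0; exists i; by rewrite mxE normr_gt0.
(* Strict positivity of [M] spreads one positive entry of [w] to all of [w *m M], hence to all of
   [w]; it also excludes [d = 0]. *)
have wM_gt0 j : 0 < `|d| * w 0 j.
  rewrite -wM_eq mxE (bigD1 i1) //= ltr_wpDr //; last first.
    by apply: mulr_gt0 => //; rewrite mxE.
  by apply: sumr_ge0 => i _; rewrite mulr_ge0 // [M _ _]mxE ltW.
have w_gt0 j : 0 < w 0 j.
  rewrite lt_neqAle w_ge0 andbT eq_sym.
  by apply: contraTneq (wM_gt0 j) => ->; rewrite mulr0 ltxx.
exists (fun i => w 0 (e' i)), `|d|; split=> // j.
rewrite -wM_eq mxE (reindex e) /=; last by exists e' => i _; rewrite ?eK ?e'K.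
by apply: eq_bigr => i _; rewrite eK [M _ _]mxE e'K.
Qed.

(** Maximum principle: at an index [i] where [x i / v i] has largest modulus, row [i] writes this
    ratio as a positively weighted average of the ratios [x j / v j], and equality in the triangle
    inequality makes them all equal. *)
Lemma positive_eigenvector_unique (I : finType) (A : I -> I -> K)
    (v x : I -> K) (rho : K) :
  (forall i j, 0 < A i j) -> (forall i, 0 < v i) ->
  (forall i, \sum_j A i j * v j = rho * v i) ->
  (forall i, \sum_j A i j * x j = rho * x i) ->
  exists c, forall i, x i = c * v i.
Proof.
move=> Apos vpos Av Ax.
have [/existsP[i0 _]|/existsPn noI] := boolP [exists i : I, true]; last first.
  by exists 0 => i; have := noI i.
have vn0 i : v i != 0 by rewrite gt_eqF.
have real_r : {in xpredT, forall i, `|x i / v i| \is Num.real}.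
  by move=> i _; exact: normr_real.
have [i _ imax] := real_arg_maxP (isT : xpredT i0) real_r.
exists (x i / v i); have [xi0|xin0] := eqVneq (x i) 0.
  move=> j; have : `|x j / v j| <= `|x i / v i| := imax j isT.
  rewrite xi0 mul0r normr0 normr_le0 mulf_eq0 invr_eq0 (negPf (vn0 j)) orbF.
  by move=> /eqP ->; rewrite mul0r.
move: (imax); set c := x i / v i => cmax j.
have cn0 : c != 0 by rewrite mulf_neq0 ?invr_eq0.
(* Equality case of the triangle inequality: the left terms are bounded in modulus by the positive
   right terms, and the two eigenvector equations make the sums agree. *)
have : A i j * x j / c = A i j * v j.
  apply: (@normC_sum_upper _ _ xpredT (fun j => A i j * x j / c)
            (fun j => A i j * v j)) => // [l _|].
    have -> : A i l * x l / c = A i l * v l * ((x l / v l) / c).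
      rewrite -!mulrA; congr (_ * _); rewrite mulrCA; congr (_ * _).
      by rewrite mulrA mulfV // mul1r.
    rewrite normrM (gtr0_norm (mulr_gt0 (Apos _ _) (vpos _))).
    apply: ler_piMr; first by rewrite ltW ?mulr_gt0.
    rewrite (normrM (x l / v l)) normfV.
    by rewrite ler_pdivrMr ?normr_gt0 // mul1r; apply: cmax.
  rewrite -mulr_suml Ax Av /c invfM invrK -mulrA (mulrA (x i)).
  by rewrite mulfV // mul1r.
move=> /(congr1 ( *%R^~ c)); rewrite divfK // -mulrA.
by move/(mulfI (lt0r_neq0 (Apos _ _))) => ->; rewrite mulrC.
Qed.

End PositiveMatrices.

(** * The spectral radius of a non-negative matrix with a positive eigenvector *)

Section SpectralRadius.
Variable R : realType.

Lemma eigenvalue_trmx (F : fieldType) n (A : 'M[F]_n) : eigenvalue A^T =1 eigenvalue A.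
Proof.
move=> a; rewrite /eigenvalue !kermx_eq0 !row_free_unit -[in RHS]unitmx_tr.
by rewrite linearB /= tr_scalar_mx.
Qed.

Lemma spectral_radius_trmx n (A : 'M[R[i]]_n) :
  spectral_radius A^T = spectral_radius A.
Proof.
by rewrite /spectral_radius (funext (eigenvalue_trmx A)).
Qed.

(** Pair [v] with the modulus of a column eigenvector [x] for [z]:
    [|z| (v . |x|) <= v A |x| = rho (v . |x|)], and [v . |x| > 0], so [|z| <= rho]. The value [rho]
    is itself attained by [v]. *)
Lemma spectral_radius_left n (A : 'M[R[i]]_n) (v : 'rV[R[i]]_n) (rho : R) :
  (0 < n)%N -> (forall i j, 0 <= A i j) -> (forall i, 0 < v 0 i) ->
  v *m A = rho%:C%C *: v -> spectral_radius A = rho.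
Proof.
move=> n_gt0 A_ge0 v_gt0 vA; pose i0 := Ordinal n_gt0.
have rho_ge0 : 0 <= rho%:C%C.
  rewrite -(pmulr_lge0 _ (v_gt0 i0)); have /rowP/(_ i0) := vA.
  by rewrite !mxE => <-; apply: sumr_ge0 => i _; rewrite mulr_ge0 // ltW.
have le_rho z : eigenvalue A z -> `|z| <= rho%:C%C.
  rewrite -eigenvalue_trmx => /eigenvalueP[x xA /rV0Pn[i xi]].
  have vx_gt0 : 0 < \sum_j v 0 j * `|x 0 j|.
    rewrite (bigD1 i) //= ltr_wpDr ?mulr_gt0 ?normr_gt0 //.
    by apply: sumr_ge0 => j _; rewrite mulr_ge0 // ltW.
  rewrite -(ler_pM2r vx_gt0) !mulr_sumr.
  apply: (@le_trans _ _ (\sum_j v 0 j * \sum_l A j l * `|x 0 l|)).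
    apply: ler_sum => j _; rewrite mulrCA ler_pM2l // -normrM.
    have /rowP/(_ j) := xA; rewrite !mxE => <-.
    apply: le_trans (ler_norm_sum _ _ _) _; apply: ler_sum => l _.
    by rewrite !mxE normrM (ger0_norm (A_ge0 _ _)) mulrC.
  under eq_bigr do rewrite mulr_sumr.
  rewrite exchange_big /= le_eqVlt; apply/orP; left; apply/eqP.
  apply: eq_bigr => l _; have /rowP/(_ l) := vA; rewrite !mxE mulrA => <-.
  by rewrite mulr_suml; apply: eq_bigr => j _; rewrite mulrA.
have rho_eig : eigenvalue A rho%:C%C.
  apply/eigenvalueP; exists v => //; apply/rV0Pn; exists i0.
  by rewrite gt_eqF.
apply/eqP; rewrite eq_le /spectral_radius; apply/andP; split.
  apply: ge_sup; first by exists (complex.Re `|rho%:C%C|); exists rho%:C%C.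
  by move=> _ [z /= /le_rho lez <-]; move: lez; rewrite lecE => /andP[_].
apply: ub_le_sup.
  exists rho => _ [z /= /le_rho lez <-]; by move: lez; rewrite lecE => /andP[_].
by exists rho%:C%C => //; rewrite (ger0_norm rho_ge0).
Qed.

Lemma spectral_radius_right n (A : 'M[R[i]]_n) (v : 'rV[R[i]]_n) (rho : R) :
  (0 < n)%N -> (forall i j, 0 <= A i j) -> (forall i, 0 < v 0 i) ->
  v *m A^T = rho%:C%C *: v -> spectral_radius A = rho.
Proof.
move=> n_gt0 A_ge0 v_gt0 vA; rewrite -spectral_radius_trmx.
by apply: (spectral_radius_left n_gt0 _ v_gt0 vA) => i j; rewrite mxE.
Qed.

End SpectralRadius.

(** * Based rings *)

Section LeftDuals.
Variables (I : finType) (N : I -> I -> I -> nat) (u : I).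
Local Open Scope nat_scope.
Hypothesis Nu : forall x b, N x u b = (b == x).

(* [l x z] is the multiplicity of [z] in a left dual of [x]; half of the
   adjunction, namely [Nl], already forces left duals to be involutive. *)
Lemma duality_involution (l : I -> I -> nat) :
  (forall x a b, \sum_z l x z * N z a b <= N x b a) ->
  (forall x, exists z, 0 < l x z) ->
  exists s : I -> I,
    involutive s /\ forall x a b, N (s x) a b = N x b a.
Proof.
move=> Nl /fin_all_exists[s s_pos].
have term x z a b : l x z * N z a b <= N x b a.
  by apply: leq_trans (Nl x a b); rewrite (bigD1 z) //= leq_addr.
(* [Nl] at the unit gives [l z w <= N z w u], and [term] then bounds the product by [N x u w]: a
   left dual of a left dual of [x] contains only [x]. *)
have ll x z w : l x z * l z w <= (w == x).
  rewrite -Nu; apply: leq_trans (term x z w u); rewrite leq_mul2l.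
  apply/orP; right; apply: leq_trans (Nl z u w).
  by rewrite (bigD1 w) //= Nu eqxx muln1 leq_addr.
have back x z w : 0 < l x z -> 0 < l z w -> w = x.
  move=> lxz lzw; have := ll x z w; case: eqVneq => // _.
  by rewrite leqn0 muln_eq0 !eqn0Ngt lxz lzw.
have sK : involutive s by move=> x; apply: back (s_pos x) (s_pos (s x)).
exists s; split=> // x a b; apply/eqP; rewrite eqn_leq; apply/andP; split.
  by apply: leq_trans (term x (s x) a b); rewrite -{1}[N _ _ _]mul1n leq_mul2r s_pos orbT.
rewrite -{1}(sK x); apply: leq_trans (term (s x) (s (s x)) b a).
by rewrite -{1}[N _ _ _]mul1n leq_mul2r s_pos orbT.
Qed.

End LeftDuals.

(** [N x y z] is the coefficient of [z] in the product [x y]. The fields are the right unit law,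
    associativity, and Frobenius reciprocity for left factors; the left unit law and reciprocity for
    right factors are derived below. *)
Definition is_based_ring (I : finType) (N : I -> I -> I -> nat) (u : I)
    (s : I -> I) : Prop :=
  [/\ forall x b, N x u b = (b == x) :> nat,
      forall x y z t,
        (\sum_w N x y w * N w z t = \sum_w N y z w * N x w t)%N,
      involutive s
    & forall x a b, N (s x) a b = N x b a].

Section BasedRings.
Variables (I : finType) (N : I -> I -> I -> nat) (u : I) (s : I -> I).
Hypothesis ringN : is_based_ring N u s.
Local Open Scope nat_scope.

Let Nu x b : N x u b = (b == x) :> nat. Proof. by case: ringN. Qed.
Let NA x y z t : \sum_w N x y w * N w z t = \sum_w N y z w * N x w t.
Proof. by case: ringN. Qed.
Let sK : involutive s. Proof. by case: ringN. Qed.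
Let Ns x a b : N (s x) a b = N x b a. Proof. by case: ringN. Qed.

(** Both sides are the coefficient of [u] in the triple product of [s b], [a] and [x], since [w x]
    contains [u] exactly when [w = s x], and then once. *)
Lemma structure_rotate a x b : N a x b = N (s b) a (s x).
Proof.
have := NA (s b) a x u; rewrite (bigD1 (s x)) //= big1 => [|w]; last first.
  have -> : N w x u = N (s w) u x by rewrite -[in LHS](sK w) Ns.
  rewrite Nu => wx; rewrite (_ : x == s w = false) ?muln0 //.
  by apply/negP => /eqP xw; rewrite xw sK eqxx in wx.
rewrite (bigD1 b) //= big1 => [|w wb]; last first.
  by rewrite Ns Nu (negPf wb) muln0.
by rewrite !Ns !Nu !eqxx !muln1 !addn0.
Qed.

Lemma structure_dual_right a x b : N a x b = N b (s x) a.
Proof. by rewrite structure_rotate Ns. Qed.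

Lemma structure_1l x b : N u x b = (b == x).
Proof. by rewrite structure_rotate Nu (inj_eq (inv_inj sK)) eq_sym. Qed.

(** The product [(s a) a] contains [u], so [b (s a) a] contains [b], and some constituent [x] of
    [b (s a)] has [b] in [x a]. This makes multiplication by the sum of the basis strictly
    positive. *)
Lemma structure_transitive a b : exists x, 0 < N x a b.
Proof.
have [/existsP//|/existsPn noN] := boolP [exists x, 0 < N x a b].
have := NA b (s a) a b; rewrite big1 => [|w _]; last first.
  by move: (noN w); rewrite -eqn0Ngt => /eqP ->; rewrite muln0.
by rewrite (bigD1 u) //= Ns !Nu !eqxx.
Qed.

Local Open Scope ring_scope.

(* The Frobenius-Perron eigenvector of left multiplication by the sum of the
   basis; right multiplications commute with it, hence act on it by scalars. *)
Lemma positive_character (K : numClosedFieldType) :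
  exists chi : I -> K, (forall x, 0 < chi x) /\
    forall x y, chi x * chi y = \sum_z (N x y z)%:R * chi z.
Proof.
pose L a b : K := (\sum_x N x a b)%:R.
have Lpos a b : 0 < L a b.
  have [x Nx] := structure_transitive a b.
  by rewrite ltr0n (bigD1 x) //= addn_gt0 Nx.
have Lsym a b : L a b = L b a.
  rewrite /L (reindex_inj (inv_inj sK)) /=.
  by congr _%:R; apply: eq_bigr => x _; rewrite Ns.
have [v [rho [vpos vL]]] := positive_symmetric_eigenvector u Lpos Lsym.
have Lv a : \sum_b L a b * v b = rho * v a.
  by rewrite -vL; apply: eq_bigr => b _; rewrite Lsym mulrC.
have scal y : exists c, forall a, \sum_t (N a y t)%:R * v t = c * v a.
  apply: (positive_eigenvector_unique Lpos vpos Lv) => a.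
  transitivity (\sum_t (\sum_w (\sum_x N x a w) * N w y t)%:R * v t).
    under eq_bigr do rewrite mulr_sumr.
    rewrite exchange_big; apply: eq_bigr => t _.
    rewrite natr_sum mulr_suml; apply: eq_bigr => w _.
    by rewrite natrM mulrA.
  transitivity (\sum_t (\sum_w N a y w * \sum_x N x w t)%:R * v t).
    apply: eq_bigr => t _; congr (_%:R * _).
    under eq_bigr do rewrite big_distrl.
    under [RHS]eq_bigr do rewrite big_distrr.
    by rewrite exchange_big [RHS]exchange_big; apply: eq_bigr => x _; exact: NA.
  under eq_bigr do rewrite natr_sum mulr_suml.
  rewrite exchange_big mulr_sumr; apply: eq_bigr => w _.
  rewrite mulrCA -Lv mulr_sumr; apply: eq_bigr => t _.
  by rewrite natrM mulrA.
(* Evaluating the scalar of [y] at [u] shows that it equals [v y / v u], so this normalisation is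
   multiplicative. *)
exists (fun x => v x / v u); split=> [x|x y]; first by rewrite divr_gt0.
have vu0 : v u != 0 by rewrite gt_eqF.
have [c cP] := scal y.
have vy : v y = c * v u.
  rewrite -cP (bigD1 y) //= big1 => [|t ty]; rewrite structure_1l.
    by rewrite eqxx mul1r addr0.
  by rewrite (negPf ty) mul0r.
under [RHS]eq_bigr do rewrite mulrA.
by rewrite -mulr_suml cP vy mulfK // mulrAC [c * _]mulrC.
Qed.

End BasedRings.

(** * Left and right multiplications in a based ring, and the matrix of [x |-> p x q] *)

Section TwoSidedMultiplication.
Variables (K : numClosedFieldType) (I : finType) (N : I -> I -> I -> nat).
Variables (u : I) (s : I -> I).
Hypothesis ringN : is_based_ring N u s.

Let NA x y z t : (\sum_w N x y w * N w z t = \sum_w N y z w * N x w t)%N.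
Proof. by case: ringN. Qed.
Let sK : involutive s. Proof. by case: ringN. Qed.
Let Ns x a b : N (s x) a b = N x b a. Proof. by case: ringN. Qed.
Let Nr := structure_dual_right ringN.
Notation n := #|I|.

Definition mx_of (F : I -> I -> K) : 'M[K]_n :=
  \matrix_(i, j) F (enum_val i) (enum_val j).

(** Matrices acting on coordinate columns: [lmx] represents the ring, while [rmx] reverses
    products. *)
Definition lmx (x : I) : 'M[K]_n := mx_of (fun a b => (N x b a)%:R).
Definition rmx (y : I) : 'M[K]_n := mx_of (fun a b => (N b y a)%:R).

Lemma mx_ofM F G :
  mx_of F *m mx_of G = mx_of (fun a b => \sum_c F a c * G c b).
Proof.
apply/matrixP => i j; rewrite !mxE [RHS]big_enum_val.
by apply: eq_bigr => l _; rewrite !mxE.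
Qed.

Lemma mx_of_sum (J : finType) (F : J -> I -> I -> K) :
  \sum_j mx_of (F j) = mx_of (fun a b => \sum_j F j a b).
Proof.
apply/matrixP => i j; rewrite summxE mxE.
by apply: eq_bigr => l _; rewrite mxE.
Qed.

Lemma mx_ofZ c F : c *: mx_of F = mx_of (fun a b => c * F a b).
Proof. by apply/matrixP => i j; rewrite !mxE. Qed.

Lemma eq_mx_of F G : (forall a b, F a b = G a b) -> mx_of F = mx_of G.
Proof. by move=> FG; apply/matrixP => i j; rewrite !mxE FG. Qed.

Lemma mx_of_inj F G : mx_of F = mx_of G -> forall a b, F a b = G a b.
Proof.
move=> /matrixP FG a b; have := FG (enum_rank a) (enum_rank b).
by rewrite !mxE !enum_rankK.
Qed.

Lemma NAr x y z t : \sum_w (N x y w)%:R * (N w z t)%:R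
  = \sum_w (N y z w)%:R * (N x w t)%:R :> K.
Proof.
under eq_bigr do rewrite -natrM; under [RHS]eq_bigr do rewrite -natrM.
by rewrite -!natr_sum NA.
Qed.

Lemma lmxM x y : lmx x *m lmx y = \sum_w (N x y w)%:R *: lmx w.
Proof.
under eq_bigr do rewrite mx_ofZ.
rewrite mx_ofM mx_of_sum; apply: eq_mx_of => a b.
by rewrite NAr; apply: eq_bigr => w _; rewrite mulrC.
Qed.

Lemma rmxM x y : rmx x *m rmx y = \sum_w (N y x w)%:R *: rmx w.
Proof.
under eq_bigr do rewrite mx_ofZ.
rewrite mx_ofM mx_of_sum; apply: eq_mx_of => a b.
by rewrite -NAr; apply: eq_bigr => w _; rewrite mulrC.
Qed.

Lemma lmx_rmxC x y : lmx x *m rmx y = rmx y *m lmx x.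
Proof.
rewrite !mx_ofM; apply: eq_mx_of => a b.
under eq_bigr do rewrite mulrC; under [RHS]eq_bigr do rewrite mulrC.
by rewrite NAr.
Qed.

Lemma lmx_tr x : (lmx x)^T = lmx (s x).
Proof. by apply/matrixP => i j; rewrite !mxE Ns. Qed.

Lemma rmx_tr x : (rmx x)^T = rmx (s x).
Proof. by apply/matrixP => i j; rewrite !mxE Nr. Qed.

Variables (p q : I -> K) (lp lq : K).
Hypothesis p_star : forall x, p (s x) = p x.
Hypothesis q_star : forall x, q (s x) = q x.
Hypothesis pp : forall w, \sum_x \sum_y p x * p y * (N x y w)%:R = lp * p w.
Hypothesis qq : forall w, \sum_x \sum_y q x * q y * (N x y w)%:R = lq * q w.

(** Left multiplication by the element with coefficients [p], and below right multiplication by the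
    one with coefficients [q]. These elements model [R_D] and [R_E]: self-dual, with square a
    multiple of themselves. *)
Let P : 'M[K]_n := \sum_x p x *: lmx x.
Let Q : 'M[K]_n := \sum_x q x *: rmx x.

Lemma left_right_weightC : P *m Q = Q *m P.
Proof.
rewrite /P /Q mulmx_suml mulmx_sumr; apply: eq_bigr => x _.
rewrite mulmx_sumr mulmx_suml; apply: eq_bigr => y _.
by rewrite -!scalemxAl -!scalemxAr lmx_rmxC !scalerA mulrC.
Qed.

Lemma left_weight_tr : P^T = P.
Proof.
rewrite /P linear_sum (reindex_inj (inv_inj sK)) /=; apply: eq_bigr => x _.
by rewrite linearZ /= lmx_tr sK p_star.
Qed.

Lemma right_weight_tr : Q^T = Q.
Proof.
rewrite /Q linear_sum (reindex_inj (inv_inj sK)) /=; apply: eq_bigr => x _.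
by rewrite linearZ /= rmx_tr sK q_star.
Qed.

Lemma left_weight_idem : P *m P = lp *: P.
Proof.
rewrite {1}/P mulmx_suml.
transitivity (\sum_w (\sum_x \sum_y p x * p y * (N x y w)%:R) *: lmx w); last first.
  by rewrite scaler_sumr; apply: eq_bigr => w _; rewrite pp scalerA.
under [RHS]eq_bigr do rewrite scaler_suml.
rewrite exchange_big; apply: eq_bigr => x _ /=.
under [RHS]eq_bigr do rewrite scaler_suml.
rewrite exchange_big mulmx_sumr; apply: eq_bigr => y _ /=.
rewrite -scalemxAl -scalemxAr lmxM scalerA scaler_sumr.
by apply: eq_bigr => w _; rewrite scalerA.
Qed.

Lemma right_weight_idem : Q *m Q = lq *: Q.
Proof.
rewrite {2}/Q mulmx_sumr.
transitivity (\sum_w (\sum_x \sum_y q x * q y * (N x y w)%:R) *: rmx w); last first.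
  by rewrite scaler_sumr; apply: eq_bigr => w _; rewrite qq scalerA.
under [RHS]eq_bigr do rewrite scaler_suml.
rewrite exchange_big; apply: eq_bigr => x _ /=.
under [RHS]eq_bigr do rewrite scaler_suml.
rewrite exchange_big mulmx_suml; apply: eq_bigr => y _ /=.
rewrite -scalemxAl -scalemxAr rmxM scalerA scaler_sumr.
by apply: eq_bigr => w _; rewrite scalerA [q y * _]mulrC.
Qed.

(** The coefficient of [a] in the product [p b q]. *)
Definition two_sided (a b : I) : K :=
  \sum_w (\sum_x p x * (N x b w)%:R) * \sum_y q y * (N w y a)%:R.

Lemma two_sidedE : Q *m P = mx_of two_sided.
Proof.
rewrite /Q /P; under eq_bigr do rewrite mx_ofZ.
under [X in _ *m X]eq_bigr do rewrite mx_ofZ.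
rewrite !mx_of_sum mx_ofM; apply: eq_mx_of => a b.
by apply: eq_bigr => w _; rewrite mulrC.
Qed.

(** A product of two commuting symmetric matrices is symmetric. *)
Lemma two_sided_sym a b : two_sided a b = two_sided b a.
Proof.
have := two_sidedE; rewrite -left_right_weightC.
rewrite -{1}left_weight_tr -{1}right_weight_tr -trmx_mul two_sidedE.
move=> /(congr1 trmx); rewrite trmxK => /matrixP/(_ (enum_rank a) (enum_rank b)).
by rewrite !mxE !enum_rankK.
Qed.

Lemma two_sided_idem a c :
  \sum_b two_sided a b * two_sided b c = lp * lq * two_sided a c.
Proof.
move: a c; apply: mx_of_inj; rewrite -mx_ofM -mx_ofZ -two_sidedE.
rewrite mulmxA -(mulmxA Q) left_right_weightC mulmxA right_weight_idem.
rewrite -mulmxA left_weight_idem.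
by rewrite -scalemxAl -scalemxAr scalerA mulrC.
Qed.

Hypotheses (p_ge0 : forall x, 0 <= p x) (q_ge0 : forall x, 0 <= q x).

Lemma two_sided_ge0 a b : 0 <= two_sided a b.
Proof.
by apply: sumr_ge0 => w _; apply: mulr_ge0; apply: sumr_ge0 => x _;
  rewrite mulr_ge0 ?ler0n.
Qed.

Variable d : I -> K.
Hypothesis dM : forall x y, d x * d y = \sum_z (N x y z)%:R * d z.
Hypothesis ds : forall x, d (s x) = d x.
Hypothesis pd : \sum_x p x * d x = lp.
Hypothesis qd : \sum_x q x * d x = lq.

(** Reciprocity turns the sum of [N x b w * d b] over [b] into [d (s x) * d w], because [d] is a
    character; summing against [p] gives the factor [lp]. The right factor is treated alike. *)
Lemma two_sided_eigen a : \sum_b two_sided a b * d b = lp * lq * d a.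
Proof.
transitivity (\sum_w (lp * d w) * \sum_y q y * (N w y a)%:R).
  under eq_bigr do rewrite mulr_suml.
  rewrite exchange_big; apply: eq_bigr => w _ /=.
  under eq_bigr do rewrite mulrAC.
  rewrite -mulr_suml; congr (_ * _).
  under eq_bigr do rewrite mulr_suml.
  rewrite exchange_big -pd mulr_suml; apply: eq_bigr => x _ /=.
  under eq_bigr do rewrite -mulrA.
  rewrite -mulr_sumr -mulrA; congr (_ * _); rewrite -(ds x) dM.
  by apply: eq_bigr => b _; rewrite Ns.
under eq_bigr do rewrite -mulrA mulr_sumr.
rewrite -mulr_sumr -mulrA; congr (_ * _).
rewrite exchange_big -qd mulr_suml; apply: eq_bigr => y _ /=.
under eq_bigr do rewrite mulrCA.
rewrite -mulr_sumr -mulrA; congr (_ * _); rewrite mulrC -(ds y) dM.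
by apply: eq_bigr => w _; rewrite Nr mulrC.
Qed.

Hypothesis (lp_gt0 : 0 < lp) (lq_gt0 : 0 < lq) (d_gt0 : forall x, 0 < d x).

(** The entry of the squared matrix at [(a, c)] is at least its term through [b], and the square is
    a positive multiple of the matrix. *)
Lemma two_sided_trans a b c :
  0 < two_sided a b -> 0 < two_sided b c -> 0 < two_sided a c.
Proof.
move=> ab bc; rewrite -(pmulr_rgt0 _ (mulr_gt0 lp_gt0 lq_gt0)).
rewrite -two_sided_idem (bigD1 b) //= ltr_wpDr ?mulr_gt0 //.
by apply: sumr_ge0 => x _; rewrite mulr_ge0 ?two_sided_ge0.
Qed.

(** Row [a] is not zero, since its pairing with [d] is positive; a positive entry at [(a, b)] leads
    back to [a] by symmetry and transitivity. *)
Lemma two_sided_refl a : 0 < two_sided a a.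
Proof.
have [/existsP[b ab]|/existsPn noB] := boolP [exists b, 0 < two_sided a b].
  by apply: (two_sided_trans ab); rewrite two_sided_sym.
have := mulr_gt0 (mulr_gt0 lp_gt0 lq_gt0) (d_gt0 a).
rewrite -two_sided_eigen big1 ?ltxx // => b _.
have := noB b; rewrite lt_def two_sided_ge0 andbT negbK => /eqP ->.
by rewrite mul0r.
Qed.

End TwoSidedMultiplication.

(** * Hom spaces *)

Section LinearMaps.
Variable k : fieldType.

Definition linear_map (U V : vectType k) (f : U -> V) (lf : linear f) :
  {linear U -> V} := HB.pack f (GRing.isLinear.Build k U V *:%R f lf).

Lemma linear_map0 (U V : vectType k) (f : U -> V) : linear f -> f 0 = 0.
Proof. by move=> lf; apply: (linear0 (linear_map lf)). Qed.

Lemma linear_mapN (U V : vectType k) (f : U -> V) : linear f ->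
  forall x, f (- x) = - f x.
Proof. by move=> lf; apply: (linearN (linear_map lf)). Qed.

Lemma linear_mapD (U V : vectType k) (f : U -> V) : linear f ->
  forall x y, f (x + y) = f x + f y.
Proof. by move=> lf; apply: (linearD (linear_map lf)). Qed.

Lemma linear_map_sum (U V : vectType k) (f : U -> V) : linear f ->
  forall (I : finType) (F : I -> U), f (\sum_i F i) = \sum_i f (F i).
Proof. by move=> lf I F; apply: (linear_sum (linear_map lf)). Qed.

Lemma dim_limg_inj (U V : vectType k) (f : U -> V) (lf : linear f) :
  (forall x, f x = 0 -> x = 0) -> \dim (limg (linfun (linear_map lf))) = \dim {:U}.
Proof.
move=> f0; apply: limg_dim_eq; apply/eqP; rewrite -subv0; apply/subvP => x.
rewrite memv_cap memv_ker lfunE /= memv0 => /andP[_ /eqP fx].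
by apply/eqP; apply: f0.
Qed.

Lemma dim_inj (U V : vectType k) (f : U -> V) : linear f ->
  (forall x, f x = 0 -> x = 0) -> (\dim {:U} <= \dim {:V})%N.
Proof. by move=> lf /(dim_limg_inj lf) <-; rewrite dimvS ?subvf. Qed.

(** The images of the injections [i j] span [V] and are independent, as applying [p l] to a
    vanishing sum isolates its component [l]. *)
Lemma dim_biproduct (I : finType) (V : vectType k) (U : I -> vectType k)
    (i : forall j, U j -> V) (p : forall j, V -> U j) :
  (forall j, linear (i j)) -> (forall j, linear (p j)) ->
  (forall j x, p j (i j x) = x) ->
  (forall j l x, j != l -> p l (i j x) = 0) ->
  (forall x, \sum_j i j (p j x) = x) ->
  \dim {:V} = (\sum_j \dim {:U j})%N.
Proof.
move=> li lp pi_id pi_0 ip_id.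
pose W j : {vspace V} := limg (linfun (linear_map (li j))).
have memW j x : i j x \in W j.
  by apply/memv_imgP; exists x; rewrite ?memvf // lfunE.
have -> : {:V}%VS = (\sum_j W j)%VS.
  apply/eqP; rewrite eqEsubv subvf andbT; apply/subvP => x _.
  by rewrite -(ip_id x); apply: memv_sumr => j _; apply: memW.
have dW : directv (\sum_j W j).
  apply/directv_sum_independent => us us_in us0 l _.
  have /fin_all_exists[x xE] : forall j, exists x : U j, us j = i j x.
    by move=> j; have /memv_imgP[x _ ->] := us_in j isT; exists x; rewrite lfunE.
  have := congr1 (p l) us0; rewrite (linear_map_sum (lp l)) (linear_map0 (lp l)).
  rewrite (bigD1 l) //= big1 => [|j jl]; last by rewrite xE pi_0.
  by rewrite addr0 xE pi_id => ->; rewrite (linear_map0 (li l)).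
rewrite (directvP dW) /=; apply: eq_bigr => j _.
apply: dim_limg_inj => x ix0.
by rewrite -(pi_id j x) ix0 (linear_map0 (lp j)).
Qed.

End LinearMaps.

(** * Dimensions of Hom spaces, split summands and Schur's lemma *)

Section HomDimensions.
Local Open Scope cat_scope.
Variables (k : fieldType) (C : linCat k).
Implicit Types X Y Z W S : C.

Definition hdim X Y : nat := \dim {: Hom X Y}.

Lemma comp_lin_l X Y Z (f : Hom X Y) : linear (fun g : Hom Y Z => g ∘ f).
Proof. by move=> a g g'; apply: comp_linearl. Qed.

Lemma comp_lin_r X Y Z (g : Hom Y Z) : linear (fun f : Hom X Y => g ∘ f).
Proof. by move=> a f f'; apply: comp_linearr. Qed.

Lemma comp0m X Y Z (f : Hom X Y) : (0 : Hom Y Z) ∘ f = 0.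
Proof. exact: (linear_map0 (@comp_lin_l X Y Z f)). Qed.

Lemma compm0 X Y Z (g : Hom Y Z) : g ∘ (0 : Hom X Y) = 0.
Proof. exact: (linear_map0 (@comp_lin_r X Y Z g)). Qed.

Lemma compDm X Y Z (g g' : Hom Y Z) (f : Hom X Y) :
  (g + g') ∘ f = g ∘ f + g' ∘ f.
Proof. exact: (linear_mapD (@comp_lin_l X Y Z f)). Qed.

Lemma compmD X Y Z (g : Hom Y Z) (f f' : Hom X Y) :
  g ∘ (f + f') = g ∘ f + g ∘ f'.
Proof. exact: (linear_mapD (@comp_lin_r X Y Z g)). Qed.

Lemma compNm X Y Z (g : Hom Y Z) (f : Hom X Y) : (- g) ∘ f = - (g ∘ f).
Proof. exact: (linear_mapN (@comp_lin_l X Y Z f)). Qed.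

Lemma compmN X Y Z (g : Hom Y Z) (f : Hom X Y) : g ∘ (- f) = - (g ∘ f).
Proof. exact: (linear_mapN (@comp_lin_r X Y Z g)). Qed.

Lemma comp_suml X Y Z (I : finType) (F : I -> Hom Y Z) (f : Hom X Y) :
  (\sum_i F i) ∘ f = \sum_i (F i ∘ f).
Proof. exact: (linear_map_sum (@comp_lin_l X Y Z f)). Qed.

Lemma comp_sumr X Y Z (I : finType) (F : I -> Hom X Y) (g : Hom Y Z) :
  g ∘ (\sum_i F i) = \sum_i (g ∘ F i).
Proof. exact: (linear_map_sum (@comp_lin_r X Y Z g)). Qed.

Lemma hdim_sumr (I : finType) (F : I -> C) Z W :
  is_direct_sum F W -> hdim Z W = (\sum_j hdim Z (F j))%N.
Proof.
move=> [i [p [pi_id pi_0 ip_id]]].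
apply: (@dim_biproduct _ _ _ (fun j => Hom Z (F j))
  (fun j f => i j ∘ f) (fun j f => p j ∘ f)).
- by move=> j; apply: comp_lin_r.
- by move=> j; apply: comp_lin_r.
- by move=> j f; rewrite compA pi_id comp1m.
- by move=> j l f jl; rewrite compA pi_0 // comp0m.
move=> f; under eq_bigr do rewrite compA.
by rewrite -comp_suml ip_id comp1m.
Qed.

Lemma hdim_suml (I : finType) (F : I -> C) Z W :
  is_direct_sum F W -> hdim W Z = (\sum_j hdim (F j) Z)%N.
Proof.
move=> [i [p [pi_id pi_0 ip_id]]].
apply: (@dim_biproduct _ _ _ (fun j => Hom (F j) Z)
  (fun j f => f ∘ p j) (fun j f => f ∘ i j)).
- by move=> j; apply: comp_lin_l.
- by move=> j; apply: comp_lin_l.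
- by move=> j f; rewrite -compA pi_id compm1.
- by move=> j l f jl; rewrite -compA pi_0 1?eq_sym // compm0.
move=> f; under eq_bigr do rewrite -compA.
by rewrite -comp_sumr ip_id compm1.
Qed.

Lemma isomorphic_refl X : isomorphic X X.
Proof. by exists (idm X), (idm X); split; rewrite comp1m. Qed.

Lemma isomorphic_sym X Y : isomorphic X Y -> isomorphic Y X.
Proof. by move=> [f [g [gf fg]]]; exists g, f. Qed.

Lemma isomorphic_trans X Y Z : isomorphic X Y -> isomorphic Y Z -> isomorphic X Z.
Proof.
move=> [f [g [gf fg]]] [f' [g' [gf' fg']]]; exists (f' ∘ f), (g ∘ g'); split.
  by rewrite compA -(compA g g' f') gf' compm1.
by rewrite compA -(compA f' f g) fg compm1.
Qed.

Lemma hdim_isol X Y Z : isomorphic X Y -> hdim X Z = hdim Y Z.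
Proof.
move=> [f [g [gf fg]]]; apply/eqP; rewrite eqn_leq; apply/andP; split.
  apply: (dim_inj (@comp_lin_l Y X Z g)) => h hg.
  by rewrite -(compm1 h) -gf compA hg comp0m.
apply: (dim_inj (@comp_lin_l X Y Z f)) => h hf.
by rewrite -(compm1 h) -fg compA hf comp0m.
Qed.

Lemma hdim_isor X Y Z : isomorphic X Y -> hdim Z X = hdim Z Y.
Proof.
move=> [f [g [gf fg]]]; apply/eqP; rewrite eqn_leq; apply/andP; split.
  apply: (dim_inj (@comp_lin_r Z X Y f)) => h hg.
  by rewrite -(comp1m h) -gf -compA hg compm0.
apply: (dim_inj (@comp_lin_r Z Y X g)) => h hf.
by rewrite -(comp1m h) -fg -compA hf compm0.
Qed.

Lemma direct_sum_iso (I : finType) (F G : I -> C) W :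
  (forall j, isomorphic (F j) (G j)) ->
  is_direct_sum F W -> is_direct_sum G W.
Proof.
move=> FG; pose f j := sval (cid (FG j)).
pose g j := sval (cid (svalP (cid (FG j)))).
have gf j : g j ∘ f j = idm (F j) by case: (svalP (cid (svalP (cid (FG j))))).
have fg j : f j ∘ g j = idm (G j) by case: (svalP (cid (svalP (cid (FG j))))).
move=> [i [p [pi_id pi_0 ip_id]]].
exists (fun j => i j ∘ g j), (fun j => f j ∘ p j); split.
- by move=> j; rewrite compA -(compA (f j)) pi_id compm1 fg.
- by move=> j l jl; rewrite compA -(compA (f l)) pi_0 // compm0 comp0m.
rewrite -ip_id; apply: eq_bigr => j _.
by rewrite compA -(compA (i j)) gf compm1.
Qed.

Lemma hdim_eq0P X Y : hdim X Y = 0%N <-> forall f : Hom X Y, f = 0.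
Proof.
split=> [/eqP|H]; last first.
  apply/eqP; rewrite dimv_eq0; apply/eqP/vspaceP => f.
  by rewrite (H f) !mem0v.
by rewrite dimv_eq0 => /eqP e f; apply/eqP; rewrite -memv0 -e memvf.
Qed.

Lemma is_zeroP X : is_zero X <-> hdim X X = 0%N.
Proof.
rewrite hdim_eq0P; split=> [X0 f|]; last exact.
by rewrite -(comp1m f) X0 comp0m.
Qed.

Hypothesis Cab : is_abelian C.

(** The complement is the kernel of [g]; its projection is the factorisation of [idm W - f ∘ g]
    through that kernel. *)
Lemma split_summand Y W (f : Hom Y W) (g : Hom W Y) :
  g ∘ f = idm Y -> is_summand Y W.
Proof.
move=> gf; have [_ /(_ W Y g)[Z [i [gi ker]]] _ _ _] := Cab.
have [|p [ip puniq]] := ker W (idm W - f ∘ g).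
  by rewrite compmD compmN compm1 compA gf comp1m subrr.
have imono V (h h' : Hom V Z) : i ∘ h = i ∘ h' -> h = h'.
  move=> e; have [|t [_ tu]] := ker V (i ∘ h); first by rewrite compA gi comp0m.
  by rewrite -(tu h) // -(tu h').
exists Z.
exists (fun b => if b return Hom (if b then Y else Z) W then f else i).
exists (fun b => if b return Hom W (if b then Y else Z) then g else p).
split=> [[]|[] []|] //=.
- apply: imono; rewrite compA ip compm1 compDm comp1m compNm -compA gi.
  by rewrite compm0 subr0.
- move=> _; apply: imono; rewrite compA ip compm0 compDm comp1m compNm -compA gf.
  by rewrite compm1 subrr.
by rewrite big_bool /= ip addrC subrK.
Qed.

(** The kernel of a non-zero [f] is a subobject of the simple [S], and not all of it, so it is zero.
    Then [f] is a monomorphism into the simple [S'] with non-zero source, hence invertible. *)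
Lemma Schur_iso S S' : is_simple S -> is_simple S' -> hdim S S' <> 0%N ->
  isomorphic S S'.
Proof.
move=> [S0 Ss] [S'0 S's] /hdim_eq0P/existsNP[f f0].
have [_ /(_ S S' f)[K [i [fi ker]]] _ _ _] := Cab.
have imono : mono i.
  move=> V h h' e; have [|t [_ tu]] := ker V (i ∘ h).
    by rewrite compA fi comp0m.
  by rewrite -(tu h) // -(tu h').
have [K0|[j [ji ij]]] := Ss K i imono; last first.
  by case: f0; rewrite -(compm1 f) -ij compA fi comp0m.
have fmono : mono f.
  move=> V h h' e; apply/eqP; rewrite -subr_eq0; apply/eqP.
  have [|t [<- _]] := ker V (h - h'); first by rewrite compmD compmN e subrr.
  by rewrite -(comp1m t) K0 comp0m compm0.
by have [//|iso_f] := S's S f fmono; exists f.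
Qed.

End HomDimensions.

(** * Tensor products and duals *)

Section TensorProducts.
Local Open Scope cat_scope.
Variables (k : fieldType) (C : linMonCat k).
Implicit Types A B V W X Y Z : C.

Lemma tens_lin_l X X' Y Y' (g : Hom Y Y') :
  linear (fun f : Hom X X' => f ⊠ g).
Proof. by move=> a f f'; apply: tensm_linearl. Qed.

Lemma tens_lin_r X X' Y Y' (f : Hom X X') :
  linear (fun g : Hom Y Y' => f ⊠ g).
Proof. by move=> a g g'; apply: tensm_linearr. Qed.

Lemma tensm_compr X Y Y' Y'' (g' : Hom Y' Y'') (g : Hom Y Y') :
  idm X ⊠ (g' ∘ g) = (idm X ⊠ g') ∘ (idm X ⊠ g).
Proof. by rewrite -tensm_comp comp1m. Qed.

Lemma tensm_compl X X' X'' Y (f' : Hom X' X'') (f : Hom X X') :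
  (f' ∘ f) ⊠ idm Y = (f' ⊠ idm Y) ∘ (f ⊠ idm Y).
Proof. by rewrite -tensm_comp comp1m. Qed.

Lemma direct_sum_tensl (I : finType) (F : I -> C) V W :
  is_direct_sum F V -> is_direct_sum (fun j => F j ⊗ W) (V ⊗ W).
Proof.
move=> [i [p [pi_id pi_0 ip_id]]].
exists (fun j => i j ⊠ idm W), (fun j => p j ⊠ idm W); split.
- by move=> j; rewrite -tensm_comp pi_id comp1m tensm1.
- move=> j l jl; rewrite -tensm_comp pi_0 //.
  exact: (linear_map0 (@tens_lin_l _ _ _ _ _)).
under eq_bigr do rewrite -tensm_comp comp1m.
by rewrite -(linear_map_sum (@tens_lin_l _ _ _ _ _)) ip_id tensm1.
Qed.

Lemma direct_sum_tensr (I : finType) (F : I -> C) V W :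
  is_direct_sum F W -> is_direct_sum (fun j => V ⊗ F j) (V ⊗ W).
Proof.
move=> [i [p [pi_id pi_0 ip_id]]].
exists (fun j => idm V ⊠ i j), (fun j => idm V ⊠ p j); split.
- by move=> j; rewrite -tensm_comp pi_id comp1m tensm1.
- move=> j l jl; rewrite -tensm_comp pi_0 //.
  exact: (linear_map0 (@tens_lin_r _ _ _ _ _)).
under eq_bigr do rewrite -tensm_comp comp1m.
by rewrite -(linear_map_sum (@tens_lin_r _ _ _ _ _)) ip_id tensm1.
Qed.

Lemma assoc_iso X Y Z : isomorphic ((X ⊗ Y) ⊗ Z) (X ⊗ (Y ⊗ Z)).
Proof. by exists (assoc X Y Z), (assocV X Y Z); apply: assocK. Qed.

Lemma runit_iso X : isomorphic (X ⊗ unitOb C) X.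
Proof. by exists (runit X), (runitV X); apply: runitK. Qed.

Lemma assocV_nat X X' Y Y' Z Z' (f : Hom X X') (g : Hom Y Y') (h : Hom Z Z') :
  assocV X' Y' Z' ∘ (f ⊠ (g ⊠ h)) = ((f ⊠ g) ⊠ h) ∘ assocV X Y Z.
Proof.
have [aK _] := assocK X' Y' Z'; have [_ Ka] := assocK X Y Z.
rewrite -[RHS]comp1m -aK -(compA (assocV _ _ _)) (compA (assoc _ _ _)) assoc_nat.
by rewrite -(compA _ (assoc X Y Z)) Ka compm1.
Qed.

(* [E] is [z ⊠ idm A] up to coherence, with [z] the zigzag of the pair, hence
   [idm]; that [E] has a right inverse suffices, and does not need the
   coherence [lunit (X ⊗ Y) ∘ assoc 1 X Y = lunit X ⊠ idm Y]. *)
Lemma dual_pair_hdim Y X A B :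
  is_dual_pair Y X -> (hdim (Y ⊗ A) B <= hdim A (X ⊗ B))%N.
Proof.
move=> [ev [coev [_ zigzag]]].
(* The adjunct of [f]; the dimension bound only asks that [f |-> adj f] be injective. *)
pose adj (f : Hom (Y ⊗ A) B) : Hom A (X ⊗ B) :=
  (idm X ⊠ f) ∘ (assoc X Y A ∘ (coev ⊠ idm A) ∘ lunitV A).
have adj_lin : linear adj.
  by move=> a f f'; rewrite /adj tensm_linearr comp_linearl.
apply: (dim_inj adj_lin) => f adjf0.
pose E := lunit (Y ⊗ A) ∘ (ev ⊠ idm (Y ⊗ A)) ∘ assocV Y X (Y ⊗ A)
  ∘ (idm Y ⊠ (assoc X Y A ∘ (coev ⊠ idm A) ∘ lunitV A)).
(* Naturality carries [f] across to the other end, where it appears only through [adj f]; so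
   [adj f = 0] forces [f ∘ E = 0]. *)
have fE : f ∘ E = lunit B ∘ (ev ⊠ idm B) ∘ assocV Y X B ∘ (idm Y ⊠ adj f).
  rewrite /adj -[idm Y in RHS](comp1m (idm Y)) tensm_comp !compA.
  rewrite -(compA _ (assocV Y X B)) assocV_nat !compA.
  rewrite -(compA _ (ev ⊠ idm B)) -tensm_comp tensm1 compm1 comp1m.
  by rewrite -lunit_nat -(compA (lunit B)) -tensm_comp comp1m compm1.
suff [g Eg] : exists g, E ∘ g = idm (Y ⊗ A).
  rewrite -(compm1 f) -Eg compA fE adjf0 (linear_map0 (@tens_lin_r _ _ _ _ _)).
  by rewrite compm0 comp0m.
have [lu_id id_lu] := lunitK Y.
have [a1 a2] := assocK Y X Y.
have [b1 b2] := assocK Y (X ⊗ Y) A.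
have [c1 c2] := assocK Y X (Y ⊗ A).
(* The pentagon at [Y], [X], [Y], [A], solved for this composite. *)
have pent : assocV Y X (Y ⊗ A) ∘ (idm Y ⊠ assoc X Y A)
    = assoc (Y ⊗ X) Y A ∘ (assocV Y X Y ⊠ idm A) ∘ assocV Y (X ⊗ Y) A.
  have e : idm Y ⊠ assoc X Y A = assoc Y X (Y ⊗ A) ∘ assoc (Y ⊗ X) Y A
      ∘ (assocV Y X Y ⊠ idm A) ∘ assocV Y (X ⊗ Y) A.
    rewrite pentagon -(compA _ (assoc Y X Y ⊠ idm A)) -tensm_comp a2 comp1m.
    by rewrite tensm1 compm1 -compA b2 compm1.
  by rewrite e !compA c1 comp1m.
have tri : assocV Y (unitOb C) A ∘ (idm Y ⊠ lunitV A) = runitV Y ⊠ idm A.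
  have [d1 _] := assocK Y (unitOb C) A.
  have e : (idm Y ⊠ lunit A) ∘ (assoc Y (unitOb C) A ∘ (runitV Y ⊠ idm A))
      = idm (Y ⊗ A).
    rewrite compA triangle -tensm_comp comp1m.
    by have [_ ->] := runitK Y; rewrite tensm1.
  have [l1 _] := lunitK A.
  have e' : (idm Y ⊠ lunitV A) ∘ (idm Y ⊠ lunit A) = idm (Y ⊗ (unitOb C ⊗ A)).
    by rewrite -tensm_comp l1 comp1m tensm1.
  rewrite -(compm1 (idm Y ⊠ lunitV A)) -e (compA (idm Y ⊠ lunitV A)) e' comp1m.
  by rewrite compA d1 comp1m.
(* The zigzag without its final [lunit Y], which is therefore the inverse of [lunit Y]. *)
pose Q := (ev ⊠ idm Y) ∘ assocV Y X Y ∘ (idm Y ⊠ coev) ∘ runitV Y.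
have QE : Q = lunitV Y.
  have lQ : lunit Y ∘ Q = idm Y by rewrite /Q !compA.
  by rewrite -(comp1m Q) -lu_id -compA lQ compm1.
have EE : E = lunit (Y ⊗ A) ∘ assoc (unitOb C) Y A ∘ (Q ⊠ idm A).
  rewrite /E !tensm_compr !compA.
  rewrite -(compA _ (assocV Y X (Y ⊗ A))) pent !compA.
  rewrite -(compA _ (assocV Y (X ⊗ Y) A)) assocV_nat !compA.
  rewrite -(compA _ (assocV Y (unitOb C) A)) tri.
  rewrite -[idm (Y ⊗ A)]tensm1 -(compA _ (ev ⊠ _)) -assoc_nat !compA.
  by rewrite /Q !tensm_compl !compA.
(* The inverses of the three isomorphisms composing [E], in reverse order. *)
exists ((lunit Y ⊠ idm A) ∘ assocV (unitOb C) Y A ∘ lunitV (Y ⊗ A)).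
rewrite EE QE !compA -(compA _ (lunitV Y ⊠ idm A)) -tensm_comp lu_id comp1m.
rewrite tensm1 compm1 -(compA _ (assoc _ _ _)).
have [_ ->] := assocK (unitOb C) Y A.
by rewrite compm1; have [_ ->] := lunitK (Y ⊗ A).
Qed.

End TensorProducts.

(** * The based ring of a fusion category *)

Section FusionCategory.
Local Open Scope cat_scope.
Variables (k : fieldType) (C : linMonCat k).
Hypothesis Cfus : is_fusion C.
Implicit Types V W S : C.
Implicit Types X Y Z : Lambda C.

Let Cab : is_abelian C. Proof. by have [[]] := Cfus. Qed.

Lemma LambdaE X : exists2 S : C, is_simple S & fsval X = iso_class S.
Proof.
have [_ _ fin _ _] := Cfus.
have := fsvalP X; rewrite in_fset_set // => /set_mem[S Ssimple <-].
by exists S.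
Qed.

(** Classes are non-empty, so the default value in [repr] never occurs. *)
Lemma repr_in X : fsval X (repr X).
Proof.
rewrite /repr; case: pselect => [exZ|noZ]; first by case: (cid exZ).
by case: noZ; have [S _ ->] := LambdaE X; exists S; apply: isomorphic_refl.
Qed.

Lemma simple_repr S : is_simple S -> exists X, isomorphic S (repr X).
Proof.
move=> Ssimple; have [_ _ fin _ _] := Cfus.
have SL : iso_class S \in fset_set (simple_classes C).
  by rewrite in_fset_set //; apply/mem_set; exists S.
by exists [` SL]%fset; have := repr_in [` SL]%fset.
Qed.

Lemma isomorphic_repr X Y : isomorphic (repr X) (repr Y) -> X = Y.
Proof.
move=> XY; apply/val_inj => /=.
have := repr_in X; have := repr_in Y.
have [S _ ->] := LambdaE X; have [S' _ ->] := LambdaE Y.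
rewrite /iso_class /= => S'Y SX; apply/seteqP; split=> Z /= h.
  apply: isomorphic_trans S'Y (isomorphic_trans (isomorphic_sym XY) _).
  exact: isomorphic_trans (isomorphic_sym SX) h.
apply: isomorphic_trans SX (isomorphic_trans XY _).
exact: isomorphic_trans (isomorphic_sym S'Y) h.
Qed.

Lemma hdim_simple S : is_simple S -> hdim S S = 1%N.
Proof.
move=> Ssimple; have [_ _ _ End _] := Cfus.
rewrite /hdim; have -> : {:Hom S S}%VS = <[idm S]>%VS.
  apply/eqP; rewrite eqEsubv subvf andbT; apply/subvP => f _.
  by have [a [-> _]] := End S Ssimple f; rewrite memvZ ?memv_line.
by rewrite dim_vline; case: eqP => // id0; case: Ssimple.
Qed.

Lemma hdim_repr X Y : hdim (repr X) (repr Y) = (X == Y) :> nat.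
Proof.
have [S Ssimple XS] := LambdaE X; have [S' S'simple YS'] := LambdaE Y.
have := repr_in X; rewrite XS => SX; have := repr_in Y; rewrite YS' => S'Y.
have [<-|XY] := eqVneq X Y.
  by rewrite -(hdim_isol _ SX) -(hdim_isor _ SX) hdim_simple.
rewrite -(hdim_isol _ SX) -(hdim_isor _ S'Y); apply/eqP/negPn/negP => /eqP h.
case/eqP: XY; apply: isomorphic_repr.
apply: isomorphic_trans (isomorphic_sym SX) _.
exact: isomorphic_trans (Schur_iso Cab Ssimple S'simple h) S'Y.
Qed.

(** The second clause trades a sum over the chosen simple factors for one over classes weighted by
    multiplicity; different choices of [g] give the expansions below. *)
Lemma decomposition W : exists n (c : 'I_n -> Lambda C),
  is_direct_sum (fun j => repr (c j)) W /\
  forall g : Lambda C -> nat,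
    (\sum_j g (c j) = \sum_X hdim (repr X) W * g X)%N.
Proof.
have [[_ /(_ W)[n [F [Fsimple FW]]]] _ _ _ _] := Cfus.
have /fin_all_exists[c cP] : forall j, exists X, isomorphic (F j) (repr X).
  by move=> j; apply: simple_repr.
have cW := direct_sum_iso cP FW; exists n, c; split=> // g.
under [RHS]eq_bigr do rewrite (hdim_sumr _ cW) big_distrl.
rewrite exchange_big; apply: eq_bigr => j _ /=.
rewrite (bigD1 (c j)) //= hdim_repr eqxx mul1n big1 ?addn0 // => X Xc.
by rewrite hdim_repr (negPf Xc).
Qed.

Lemma hdim_expand V W :
  hdim V W = (\sum_X hdim (repr X) V * hdim (repr X) W)%N.
Proof.
have [n [c [cV cg]]] := decomposition V.
by rewrite (hdim_suml _ cV) (cg (fun X => hdim (repr X) W)).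
Qed.

Lemma hdim_sym V W : hdim V W = hdim W V.
Proof. by rewrite !hdim_expand; apply: eq_bigr => X _; rewrite mulnC. Qed.

Lemma hdim_tensl Z V W :
  hdim (repr Z) (V ⊗ W)
  = (\sum_X hdim (repr X) V * hdim (repr Z) (repr X ⊗ W))%N.
Proof.
have [n [c [cV cg]]] := decomposition V.
by rewrite (hdim_sumr _ (direct_sum_tensl _ cV)) (cg (fun X => hdim _ (repr X ⊗ W))).
Qed.

Lemma hdim_tensr Z V W :
  hdim (repr Z) (V ⊗ W)
  = (\sum_X hdim (repr X) W * hdim (repr Z) (V ⊗ repr X))%N.
Proof.
have [n [c [cW cg]]] := decomposition W.
by rewrite (hdim_sumr _ (direct_sum_tensr _ cW)) (cg (fun X => hdim _ (V ⊗ repr X))).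
Qed.

(** The squares of the multiplicities add up to 1, so exactly one multiplicity is 1 and the others
    vanish. *)
Lemma hdim1_repr W : hdim W W = 1%N ->
  exists X, forall Z, hdim (repr Z) W = (Z == X) :> nat.
Proof.
rewrite hdim_expand => W1.
have [/existsP[X mX]|/existsPn noX] := boolP [exists X, 0 < hdim (repr X) W]%N.
  exists X => Z; move: mX W1; rewrite (bigD1 X) //=.
  case mX: (hdim (repr X) W) => [|[|m]] // _; rewrite muln1 => -[/eqP].
  rewrite sum_nat_eq0 => /forallP mZ.
  have [->|ZX] := eqVneq Z X; first by rewrite mX.
  by have := mZ Z; rewrite ZX /= muln_eq0 orbb => /eqP.
by move: W1; rewrite big1 // => X _; move: (noX X); rewrite -eqn0Ngt => /eqP ->.
Qed.

Lemma summandP Y W : is_summand (repr Y) W <-> (0 < hdim (repr Y) W)%N.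
Proof.
split=> [[Z YZ]|].
  by rewrite (hdim_sumr _ YZ) big_bool /= hdim_repr eqxx.
have [n [c [cW _]]] := decomposition W; have [i [p [pi_id _ _]]] := cW.
rewrite (hdim_sumr _ cW) lt0n sum_nat_eq0 negb_forall => /existsP[j].
rewrite hdim_repr implyTb eqb0 negbK => /eqP ->.
by apply: (split_summand Cab (pi_id j)).
Qed.

Definition Nst X Y Z : nat := hdim (repr Z) (repr X ⊗ repr Y).

Lemma NstA x y z t :
  (\sum_w Nst x y w * Nst w z t = \sum_w Nst y z w * Nst x w t)%N.
Proof.
rewrite -(hdim_tensl t (repr x ⊗ repr y)) -(hdim_tensr t _ (repr y ⊗ repr z)).
exact: (hdim_isor _ (assoc_iso _ _ _)).
Qed.

Lemma unit_exists : exists u : Lambda C,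
  (forall Z, hdim (repr Z) (unitOb C) = (Z == u) :> nat) /\
  (forall x b, Nst x u b = (b == x) :> nat).
Proof.
have [_ _ _ _ /hdim_simple/hdim1_repr[u uP]] := Cfus.
exists u; split=> // x b.
rewrite -hdim_repr -(hdim_isor _ (runit_iso (repr x))) hdim_tensr.
rewrite (bigD1 u) //= uP eqxx mul1n big1 ?addn0 // => X Xu.
by rewrite uP (negPf Xu).
Qed.

(** A zero dual makes [ev] zero, and with it the zigzag that equals [idm V]. Hence duals of simple
    objects are non-zero. *)
Lemma is_zero_dual V W : is_dual_pair W V -> is_zero W -> is_zero V.
Proof.
move=> [ev [coev [zz _]]] W0; rewrite /is_zero -zz.
have -> : ev = 0.
  rewrite -(compm1 ev) -tensm1 W0.
  by rewrite (linear_map0 (@tens_lin_l _ _ _ _ _ _ _)) compm0.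
by rewrite (linear_map0 (@tens_lin_r _ _ _ _ _ _ _)) compm0 !comp0m.
Qed.

(** [duality_involution] is applied to the multiplicities in chosen left duals [L X]:
    [dual_pair_hdim] supplies the inequality, and [is_zero_dual] shows that each [L X] has a simple
    constituent. *)
Lemma based_ring_exists : exists u s, is_based_ring Nst u s.
Proof.
have [_ rig _ _ _] := Cfus; have [u [_ Nst1r]] := unit_exists.
have dual X : exists V, is_dual_pair V (repr X) by have [] := rig (repr X).
pose L X := sval (cid (dual X)).
have LP X : is_dual_pair (L X) (repr X) := svalP (cid (dual X)).
have [||s [sK Ns]] := duality_involution Nst1r (l := fun X Z => hdim (repr Z) (L X)).
- move=> x a b; rewrite -(hdim_tensl b) hdim_sym /Nst.
  exact: dual_pair_hdim (LP x).
- move=> x; apply: contrapT => /forallNP noZ.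
  have : is_zero (L x).
    apply/is_zeroP; rewrite hdim_expand big1 // => Z _.
    by have /negP := noZ Z; rewrite -eqn0Ngt => /eqP ->.
  by move=> /(is_zero_dual (LP x))/is_zeroP; rewrite hdim_repr eqxx.
by exists u, s; split=> //; exact: NstA.
Qed.

(** The class [v] of the unit object and [u] are both two-sided units; computing [Nst u v u] in two
    ways identifies them. *)
Lemma hdim_unit u s : is_based_ring Nst u s ->
  forall Z, hdim (repr Z) (unitOb C) = (Z == u) :> nat.
Proof.
move=> ringN; have [v [vP Nv]] := unit_exists; suff -> : u = v by [].
have := Nv u u; rewrite (structure_1l ringN) eqxx.
by case: eqP.
Qed.

End FusionCategory.

(** * Frobenius-Perron dimensions *)

Section GrothendieckRing.
Variables (k : fieldType) (C : linMonCat k) (R : realType).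
Implicit Types (X Y Z : Lambda C) (x y z : K0 C R).

Lemma K0mulE x y Z :
  K0mul x y Z = \sum_X \sum_Y x X * y Y * (Nst X Y Z)%:R.
Proof.
rewrite sum_ffunE; apply: eq_bigr => X _; rewrite sum_ffunE.
by apply: eq_bigr => Y _; rewrite !ffunE.
Qed.

Lemma K0basisE X Y : K0basis R X Y = (Y == X)%:R.
Proof. by rewrite ffunE. Qed.

Lemma sum_mul_eq (K : pzRingType) (I : finType) (F : I -> K) (i : I) :
  \sum_j F j * (j == i)%:R = F i.
Proof.
rewrite (bigD1 i) //= big1 => [|j ji]; first by rewrite eqxx mulr1 addr0.
by rewrite (negPf ji) mulr0.
Qed.

Lemma sum_eq_mul (K : pzRingType) (I : finType) (F : I -> K) (i : I) :
  \sum_j (j == i)%:R * F j = F i.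
Proof.
rewrite (bigD1 i) //= big1 => [|j ji]; first by rewrite eqxx mul1r addr0.
by rewrite (negPf ji) mul0r.
Qed.

Lemma K0mul_basis X Y Z :
  K0mul (K0basis R X) (K0basis R Y) Z = (Nst X Y Z)%:R.
Proof.
rewrite K0mulE.
transitivity (\sum_W (W == X)%:R * \sum_V (V == Y)%:R * (Nst W V Z)%:R : R[i]).
  apply: eq_bigr => W _; rewrite mulr_sumr; apply: eq_bigr => V _.
  by rewrite !K0basisE mulrA.
by rewrite !sum_eq_mul.
Qed.

Lemma op_matrix_mul X :
  op_matrix [set: Lambda C]%SET (K0mul (K0basis R X))
  = \matrix_(i, j) (Nst X (enum_val j) (enum_val i))%:R.
Proof. by apply/matrixP => i j; rewrite !mxE K0mul_basis. Qed.

(** The values of a positive character form a positive left eigenvector of multiplication by [X],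
    with eigenvalue [chi X]. In particular there is at most one positive character. *)
Lemma FPdim_character (chi : Lambda C -> R[i]) :
  (forall X, 0 < chi X) ->
  (forall X Y, chi X * chi Y = \sum_Z (Nst X Y Z)%:R * chi Z) ->
  forall X, (FPdim R X)%:C%C = chi X.
Proof.
move=> chi_gt0 chiM X.
have chiE : (complex.Re (chi X))%:C%C = chi X by rewrite RRe_real // gtr0_real.
rewrite -chiE; congr (_%:C)%C.
apply: (@spectral_radius_left _ _ _ (\row_j chi (enum_val j))).
- by rewrite cardsT; apply/card_gt0P; exists X.
- by move=> i j; rewrite op_matrix_mul mxE ler0n.
- by move=> i; rewrite mxE.
rewrite chiE op_matrix_mul; apply/rowP => j; rewrite !mxE chiM.
rewrite [RHS](_ : _ = \sum_(Z in [set: Lambda C]%SET)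
   (Nst X (enum_val j) Z)%:R * chi Z); last by apply: eq_bigl => Z; rewrite inE.
by rewrite [RHS]big_enum_val; apply: eq_bigr => i _; rewrite !mxE mulrC.
Qed.

(* Locked, so that comparing two values never unfolds spectral radii. *)
Fact dimC_key : unit. Proof. by []. Qed.
Definition dimC : Lambda C -> R[i] :=
  locked_with dimC_key (fun X => (FPdim R X)%:C%C).

Lemma dimCE X : dimC X = (FPdim R X)%:C%C.
Proof. by rewrite /dimC unlock. Qed.

Lemma dimC_character (chi : Lambda C -> R[i]) :
  (forall X, 0 < chi X) ->
  (forall X Y, chi X * chi Y = \sum_Z (Nst X Y Z)%:R * chi Z) -> dimC = chi.
Proof.
by move=> cp cM; apply/funext => X; rewrite dimCE (FPdim_character cp cM).
Qed.

Lemma regular_onE (B : {set Lambda C}) X :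
  regular_on R B X = if X \in B then dimC X else 0.
Proof.
rewrite sum_ffunE big_mkcond /=.
transitivity (\sum_Y (if Y \in B then dimC Y else 0) * (Y == X)%:R : R[i]).
  apply: eq_bigr => Y _; case: ifP => _; last by rewrite mul0r.
  by rewrite ffunE K0basisE eq_sym dimCE.
exact: sum_mul_eq.
Qed.

Lemma regularE X : regular C R X = dimC X.
Proof. by rewrite regular_onE inE. Qed.

Variables (u : Lambda C) (s : Lambda C -> Lambda C).
Hypothesis ringC : is_based_ring (@Nst k C) u s.

Let Ns X Y Z : Nst (s X) Y Z = Nst X Z Y. Proof. by case: ringC. Qed.

Let chi_exists : (forall X, 0 < dimC X) /\
  forall X Y, dimC X * dimC Y = \sum_Z (Nst X Y Z)%:R * dimC Z.
Proof.
have [chi [cp cM]] := positive_character ringC R[i].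
by rewrite (dimC_character cp cM).
Qed.

Lemma dimC_gt0 X : 0 < dimC X.
Proof. exact: chi_exists.1. Qed.

Lemma dimCM X Y : dimC X * dimC Y = \sum_Z (Nst X Y Z)%:R * dimC Z.
Proof. exact: chi_exists.2. Qed.

(** By reciprocity, multiplication by [s X] is the transpose of multiplication by [X]. *)
Lemma dimC_star X : dimC (s X) = dimC X.
Proof.
have op : op_matrix [set: Lambda C]%SET (K0mul (K0basis R (s X)))
    = (op_matrix [set: Lambda C]%SET (K0mul (K0basis R X)))^T.
  apply: etrans (op_matrix_mul _) _.
  apply: etrans _ (esym (congr1 trmx (op_matrix_mul X))).
  by apply/matrixP => i j; rewrite !mxE Ns.
have e : FPdim R (s X) = FPdim R X.
  have e0 := congr1 (@spectral_radius R _) op.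
  have e1 := spectral_radius_trmx (op_matrix [set: Lambda C]%SET (K0mul (K0basis R X))).
  by rewrite /FPdim; exact (etrans e0 e1).
exact: etrans (dimCE _) (etrans (congr1 (fun r : R => r%:C%C) e) (esym (dimCE X))).
Qed.

Lemma FPdim_catE : (FPdim_cat C R)%:C%C = \sum_X dimC X ^+ 2.
Proof. by rewrite rmorph_sum; apply: eq_bigr => X _; rewrite rmorphXn dimCE. Qed.

Lemma FPdim_cat_gt0 : 0 < (FPdim_cat C R)%:C%C.
Proof.
rewrite FPdim_catE (bigD1 (u)) //= ltr_wpDr ?exprn_gt0 ?dimC_gt0 //.
by apply: sumr_ge0 => X _; rewrite exprn_ge0 ?ltW ?dimC_gt0.
Qed.

(** This is [R_C R_C = FPdim(C) R_C], read at [Z]: reciprocity turns the sum over [Y] into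
    [dimC X * dimC Z]. *)
Lemma dimC_regular Z :
  \sum_X \sum_Y dimC X * dimC Y * (Nst X Y Z)%:R
  = (FPdim_cat C R)%:C%C * dimC Z.
Proof.
rewrite FPdim_catE mulr_suml; apply: eq_bigr => X _.
under eq_bigr do rewrite -mulrA; rewrite -mulr_sumr expr2 -mulrA; congr (_ * _).
rewrite -(dimC_star X) dimCM; apply: eq_bigr => Y _.
by rewrite Ns mulrC.
Qed.

End GrothendieckRing.

(** * Fusion subcategories *)

Section FusionSubcategory.
Local Open Scope cat_scope.
Variables (k : fieldType) (C : linMonCat k) (R : realType).
Hypothesis Cfus : is_fusion C.
Variable D : fusionSubcat C.
Let Dfus : is_fusion D := sub_fusion D.

Lemma direct_sum_sub (I : finType) (F : I -> D) (W : D) :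
  is_direct_sum F W -> is_direct_sum (fun j => sub_incl (F j)) (sub_incl W).
Proof. by move=> [i [p ipW]]; exists i, p. Qed.

(** A simple object of [D] has one-dimensional endomorphisms in [C] by fullness, so it has a single
    simple constituent in [C], of multiplicity 1; its class is [iota e]. *)
Lemma iota_exists : exists iota : Lambda D -> Lambda C,
  forall (W : D) Z, hdim (repr Z) (sub_incl W)
    = (\sum_e hdim (repr e) W * (Z == iota e))%N.
Proof.
have /fin_all_exists[iota iotaP] : forall e : Lambda D, exists X : Lambda C,
    forall Z, hdim (repr Z) (sub_incl (repr e)) = (Z == X) :> nat.
  move=> e; apply: (hdim1_repr Cfus).
  by transitivity (hdim (repr e) (repr e)); rewrite // (hdim_repr Dfus) eqxx.
exists iota => W Z; have [n [c [cW cg]]] := decomposition Dfus W.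
rewrite (hdim_sumr _ (direct_sum_sub cW)) -(cg (fun e => (Z == iota e) : nat)).
by apply: eq_bigr => j _; rewrite iotaP.
Qed.

Variable iota : Lambda D -> Lambda C.
Hypothesis iotaE : forall (W : D) Z, hdim (repr Z) (sub_incl W)
    = (\sum_e hdim (repr e) W * (Z == iota e))%N.

Lemma iota_repr e Z : hdim (repr Z) (sub_incl (repr e)) = (Z == iota e) :> nat.
Proof.
rewrite iotaE (bigD1 e) //= (hdim_repr Dfus) eqxx mul1n big1 ?addn0 // => f fe.
by rewrite (hdim_repr Dfus) (negPf fe).
Qed.

Lemma iota_tensl e (W : C) Z :
  hdim (repr Z) (sub_incl (repr e) ⊗ W) = hdim (repr Z) (repr (iota e) ⊗ W).
Proof.
rewrite (hdim_tensl Cfus) (bigD1 (iota e)) //= iota_repr eqxx mul1n.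
by rewrite big1 ?addn0 // => X Xe; rewrite iota_repr (negPf Xe).
Qed.

Lemma iota_tensr e (W : C) Z :
  hdim (repr Z) (W ⊗ sub_incl (repr e)) = hdim (repr Z) (W ⊗ repr (iota e)).
Proof.
rewrite (hdim_tensr Cfus) (bigD1 (iota e)) //= iota_repr eqxx mul1n.
by rewrite big1 ?addn0 // => X Xe; rewrite iota_repr (negPf Xe).
Qed.

Lemma Nst_iota e f Z :
  Nst (iota e) (iota f) Z = (\sum_g Nst e f g * (Z == iota g))%N.
Proof. by rewrite /Nst -iota_tensr -iota_tensl -iotaE. Qed.

Variables (u : Lambda C) (s : Lambda C -> Lambda C).
Hypothesis ringC : is_based_ring (@Nst k C) u s.
Variables (uD : Lambda D) (sD : Lambda D -> Lambda D).
Hypothesis ringD : is_based_ring (@Nst k D) uD sD.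

Lemma iota_unit : iota uD = u.
Proof.
have : hdim (repr u) (sub_incl (unitOb D)) = 1%N.
  by transitivity (hdim (repr u) (unitOb C)); rewrite // (hdim_unit Cfus ringC) eqxx.
rewrite iotaE (bigD1 uD) //= (hdim_unit Dfus ringD) eqxx mul1n big1 => [|e eu].
  by rewrite addn0; case: eqP.
by rewrite (hdim_unit Dfus ringD) (negPf eu).
Qed.

(** A dual is recognised by the unit: [sD e] times [e] contains [uD], so [iota (sD e)] times
    [iota e] contains [u], which determines the first factor. *)
Lemma iota_star e : s (iota e) = iota (sD e).
Proof.
have [Nu _ sK Ns] := ringC; have [NuD _ _ NsD] := ringD.
have : (0 < Nst (iota (sD e)) (iota e) u)%N.
  by rewrite Nst_iota (bigD1 uD) //= iota_unit NsD NuD !eqxx.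
rewrite -[iota (sD e)]sK Ns Nu.
by case: eqP => // -> _; rewrite !sK.
Qed.

(** The dimension of [C] restricted along [iota] is a positive character of [D], and such a
    character is unique. *)
Lemma dimC_iota : dimC R (C := D) = fun e => dimC R (iota e).
Proof.
apply: dimC_character => [e|e f]; first exact: (dimC_gt0 R ringC).
rewrite (dimCM R ringC).
under eq_bigr do rewrite Nst_iota natr_sum mulr_suml.
rewrite exchange_big; apply: eq_bigr => g _ /=.
under eq_bigr do rewrite natrM -mulrA.
by rewrite -mulr_sumr sum_eq_mul.
Qed.

(** The coefficients of [R_D] viewed in the Grothendieck ring of [C]. *)
Definition sub_weight (Z : Lambda C) : R[i] :=
  \sum_e dimC R e * (Z == iota e)%:R.

Lemma K0incl_regular Z : K0incl (regular D R) Z = sub_weight Z.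
Proof.
rewrite sum_ffunE; apply: eq_bigr => e _.
rewrite ffunE regularE ffunE; congr (_ * _%:R); exact: iota_repr.
Qed.

Lemma sum_sub_weight (F : Lambda C -> R[i]) :
  \sum_X sub_weight X * F X = \sum_e dimC R e * F (iota e).
Proof.
under eq_bigr do rewrite mulr_suml.
rewrite exchange_big; apply: eq_bigr => e _ /=.
by under eq_bigr do rewrite -mulrA; rewrite -mulr_sumr sum_eq_mul.
Qed.

Lemma sub_weight_ge0 Z : 0 <= sub_weight Z.
Proof.
apply: sumr_ge0 => e _.
by rewrite mulr_ge0 ?ler0n // ltW // (dimC_gt0 R ringD).
Qed.

Lemma sub_weight_star Z : sub_weight (s Z) = sub_weight Z.
Proof.
have [[_ _ sK _] [_ _ sDK _]] := (ringC, ringD).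
rewrite /sub_weight (reindex_inj (inv_inj sDK)); apply: eq_bigr => e _ /=.
by rewrite (dimC_star R ringD) -iota_star (inj_eq (inv_inj sK)).
Qed.

Lemma sub_weight_dim :
  \sum_X sub_weight X * dimC R X = (FPdim_cat D R)%:C%C.
Proof.
rewrite sum_sub_weight FPdim_catE; apply: eq_bigr => e _.
by rewrite expr2; congr (_ * _); rewrite dimC_iota.
Qed.

(** The relation [R_D R_D = FPdim(D) R_D] of [dimC_regular], transported along [iota]. *)
Lemma sub_weight_idem Z :
  \sum_X \sum_Y sub_weight X * sub_weight Y * (Nst X Y Z)%:R
  = (FPdim_cat D R)%:C%C * sub_weight Z.
Proof.
under eq_bigr do under eq_bigr do rewrite -mulrA.
under eq_bigr do rewrite -mulr_sumr sum_sub_weight.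
rewrite sum_sub_weight /sub_weight mulr_sumr.
transitivity (\sum_g (\sum_e \sum_f dimC R e * dimC R f * (Nst e f g)%:R)
   * (Z == iota g)%:R); last first.
  apply: eq_bigr => g _.
  by rewrite (dimC_regular R ringD) mulrA.
under [RHS]eq_bigr do rewrite mulr_suml.
rewrite exchange_big; apply: eq_bigr => e _ /=.
under [RHS]eq_bigr do rewrite mulr_suml.
rewrite exchange_big mulr_sumr; apply: eq_bigr => f _ /=.
rewrite Nst_iota natr_sum !mulr_sumr; apply: eq_bigr => g _.
by rewrite natrM !mulrA.
Qed.

End FusionSubcategory.

(** * Double cosets *)

Section DoubleCosetKernel.
Local Open Scope cat_scope.
Variables (k : fieldType) (C : linMonCat k) (R : realType).

Lemma K0spanP (B : {set Lambda C}) (x : K0 C R) :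
  x \in K0span R B <-> forall Z, Z \notin B -> x Z = 0.
Proof.
split=> [/coord_span -> Z ZB|xB].
  rewrite sum_ffunE big1 // => i _; rewrite ffunE.
  have /mapP[X XB ->] : [seq K0basis R X | X in B]`_i \in [seq K0basis R X | X in B].
    by rewrite mem_nth // size_image.
  rewrite mem_enum in XB; rewrite K0basisE.
  by rewrite (_ : Z == X = false) ?scaler0 //; apply: contraNF ZB => /eqP ->.
have -> : x = \sum_X x X *: K0basis R X.
  apply/ffunP => Z; rewrite sum_ffunE -[LHS](sum_mul_eq (fun X => x X) Z).
  by apply: eq_bigr => X _; rewrite ffunE K0basisE eq_sym.
apply: memv_suml => X _; have [XB|XB] := boolP (X \in B).
  by apply/memvZ/memv_span/map_f; rewrite mem_enum.
by rewrite xB // scale0r mem0v.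
Qed.

Hypothesis Cfus : is_fusion C.
Variables D E : fusionSubcat C.
Variables (iD : Lambda D -> Lambda C) (iE : Lambda E -> Lambda C).
Hypothesis iDE : forall (W : D) Z, hdim (repr Z) (sub_incl W)
    = (\sum_e hdim (repr e) W * (Z == iD e))%N.
Hypothesis iEE : forall (W : E) Z, hdim (repr Z) (sub_incl W)
    = (\sum_e hdim (repr e) W * (Z == iE e))%N.

Definition coset_kernel : Lambda C -> Lambda C -> R[i] :=
  two_sided (@Nst k C) (sub_weight R iD) (sub_weight R iE).

Lemma double_opE (x : K0 C R) Y :
  double_op D E x Y = \sum_X coset_kernel Y X * x X.
Proof.
rewrite /double_op K0mulE.
transitivity (\sum_W (\sum_X (\sum_A sub_weight R iD A * (Nst A X W)%:R) * x X)
   * \sum_V sub_weight R iE V * (Nst W V Y)%:R).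
  apply: eq_bigr => W _; rewrite mulr_sumr; apply: eq_bigr => V _.
  rewrite (K0incl_regular R iEE) mulrA; congr (_ * _ * _).
  rewrite K0mulE exchange_big; apply: eq_bigr => X _ /=.
  rewrite mulr_suml; apply: eq_bigr => A _.
  by rewrite (K0incl_regular R iDE) mulrAC.
under [RHS]eq_bigr do rewrite mulr_suml.
rewrite [RHS]exchange_big; apply: eq_bigr => W _ /=.
by rewrite mulr_suml; apply: eq_bigr => X _; rewrite mulrAC.
Qed.

(** Written as a combination of multiplicities in [d ⊗ X ⊗ e] with positive weights, the entry is
    positive exactly when one of these multiplicities is. *)
Lemma coset_kernelE Y X :
  coset_kernel Y X = \sum_(d : Lambda D) \sum_(e : Lambda E) dimC R d * dimC R e *
    (hdim (repr Y) (sub_incl (repr d) ⊗ repr X ⊗ sub_incl (repr e)))%:R.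
Proof.
rewrite /coset_kernel /two_sided.
under eq_bigr do rewrite (sum_sub_weight iD) (sum_sub_weight iE) mulr_suml.
rewrite exchange_big; apply: eq_bigr => d _ /=.
under eq_bigr do rewrite mulr_sumr.
rewrite exchange_big; apply: eq_bigr => e _ /=.
rewrite (hdim_tensl Cfus) natr_sum mulr_sumr; apply: eq_bigr => W _.
by rewrite (iota_tensl Cfus iDE) (iota_tensr Cfus iEE) natrM mulrACA.
Qed.

Hypothesis dimD : forall d : Lambda D, 0 < dimC R d.
Hypothesis dimE : forall e : Lambda E, 0 < dimC R e.

Lemma coset_kernel_gt0 X Y :
  0 < coset_kernel Y X <-> double_coset_rel D E X Y.
Proof.
rewrite coset_kernelE.
have term_ge0 (d : Lambda D) (e : Lambda E) (n : nat) :
    0 <= dimC R d * dimC R e * n%:R.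
  by rewrite mulr_ge0 ?ler0n // mulr_ge0 // ltW.
split=> [|[d [e /(summandP Cfus) pos]]].
  move=> t_gt0; apply: contrapT => noDE; move: t_gt0; rewrite big1 ?ltxx // => d _.
  apply: big1 => e _.
  have /negP : ~ (0 < hdim (repr Y)
      (sub_incl (repr d) ⊗ repr X ⊗ sub_incl (repr e)))%N.
    by move=> /(summandP Cfus) YdXe; apply: noDE; exists d, e.
  by rewrite -eqn0Ngt => /eqP ->; rewrite mulr0.
rewrite (bigD1 d) //= (bigD1 e) //= -addrA ltr_wpDr //.
  by rewrite addr_ge0 // ?sumr_ge0 // => a _; rewrite sumr_ge0.
by rewrite !mulr_gt0 // ltr0n.
Qed.

End DoubleCosetKernel.

(** Collects the facts about the matrix [t] of [T], hiding the units, dualities and inclusions used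
    to prove them. *)
Lemma double_op_kernel (R : realType) (k : fieldType) (C : linMonCat k)
    (Cfus : is_fusion C) (D E : fusionSubcat C) :
  exists t : Lambda C -> Lambda C -> R[i],
  [/\ forall (x : K0 C R) Y, double_op D E x Y = \sum_X t Y X * x X,
      forall X Y, 0 < t Y X <-> double_coset_rel D E X Y,
      forall Y X, 0 <= t Y X,
      (forall Y X, t Y X = t X Y) /\
      (forall X Y Z, 0 < t X Y -> 0 < t Y Z -> 0 < t X Z)
    & (forall X, 0 < t X X) /\
      forall Y, \sum_X t Y X * dimC R X
        = (FPdim_cat D R * FPdim_cat E R)%:C%C * dimC R Y].
Proof.
have Dfus : is_fusion D := sub_fusion D.
have Efus : is_fusion E := sub_fusion E.
have [u [s ringC]] := based_ring_exists Cfus.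
have [uD [sD ringD]] := based_ring_exists Dfus.
have [uE [sE ringE]] := based_ring_exists Efus.
have [iD iDE] := iota_exists Cfus D.
have [iE iEE] := iota_exists Cfus E.
have p0 := sub_weight_ge0 R iD ringD.
have q0 := sub_weight_ge0 R iE ringE.
have ps := sub_weight_star R Cfus iDE ringC ringD.
have qs := sub_weight_star R Cfus iEE ringC ringE.
have pp := sub_weight_idem R Cfus iDE ringD.
have qq := sub_weight_idem R Cfus iEE ringE.
have pd := sub_weight_dim R Cfus iDE ringC.
have qd := sub_weight_dim R Cfus iEE ringC.
have lD := FPdim_cat_gt0 R ringD.
have lE := FPdim_cat_gt0 R ringE.
have dM := dimCM R ringC.
have ds := dimC_star R ringC.
exists (coset_kernel R iD iE); split.
- exact: double_opE.
- by move=> X Y; apply: coset_kernel_gt0 => //; apply: dimC_gt0; eassumption.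
- exact: two_sided_ge0.
- split=> [Y X|X Y Z]; first exact: (two_sided_sym ringC ps qs).
  exact: (two_sided_trans ringC pp qq).
split=> [X|Y]; last first.
  by rewrite rmorphM; apply: (two_sided_eigen ringC dM ds pd qd).
exact: (two_sided_refl ringC ps qs pp qq p0 q0 dM ds pd qd lD lE (dimC_gt0 R ringC)).
Qed.

Theorem proposition2p6 (R : realType) (k : fieldType) (C : linMonCat k)
    (C_fusion : is_fusion C) (D E : fusionSubcat C)
    (B : {set Lambda C}) (B_coset : is_double_coset D E B) :
  let T := double_op (R := R) D E in
  let M := op_matrix B T in
  let lambda := FPdim_cat D R * FPdim_cat E R in
  [/\ forall x : K0 C R, x \in K0span R B -> T x \in K0span R B,
      forall i j, 0 <= M i j,
      indecomposable M,
      spectral_radius M = lambda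
    & regular_on R B != 0 /\
      forall x : K0 C R,
        (x \in K0span R B /\ T x = lambda%:C%C *: x) <->
        x \in <[regular_on R B]>%VS].
Proof.
move=> T M lambda.
have [t [TE t_rel t_ge0 [t_sym t_trans] [t_refl t_eigen]]] :=
  double_op_kernel R C_fusion D E.
have [u [s ringC]] := based_ring_exists C_fusion.
have d_gt0 := dimC_gt0 R ringC.
have {}TE : forall (x : K0 C R) Y, T x Y = \sum_X t Y X * x X := TE.
have {}t_eigen : forall Y, \sum_X t Y X * dimC R X = lambda%:C%C * dimC R Y := t_eigen.
(* From here on the coset relation enters only through the signs of [t]. *)
have {t_rel}[X0 BX0] : exists X0, forall Y, Y \in B <-> 0 < t Y X0.
  by have [X0 BX0] := B_coset; exists X0 => Y; rewrite BX0 t_rel.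
clearbody T.
(* Both indices are linked to [X0], hence to each other: the whole block of [B] is strictly
   positive. *)
have t_gt0 X Y : X \in B -> Y \in B -> 0 < t X Y.
  by move=> /BX0 tX /BX0 tY; apply: t_trans tX _; rewrite t_sym.
(* A non-zero entry is positive and would put [Y] in [B] by transitivity; this makes [T] block
   diagonal. *)
have t_out X Y : X \in B -> Y \notin B -> t X Y = 0.
  move=> /BX0 tX; apply: contraNeq => tXY; apply/BX0.
  by apply: t_trans tX; rewrite t_sym lt_def tXY t_ge0.
have ME i j : M i j = t (enum_val i) (enum_val j).
  rewrite mxE TE -[RHS](sum_mul_eq (t (enum_val i))).
  by apply: eq_bigr => X _; rewrite K0basisE.
have X0B : X0 \in B by apply/BX0.
have sumB (F : Lambda C -> R[i]) : \sum_(j < #|B|) F (enum_val j) = \sum_(X in B) F X.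
  by rewrite [RHS]big_enum_val.
have sum_supp Y (F : Lambda C -> R[i]) : Y \in B ->
    \sum_X t Y X * F X = \sum_(X in B) t Y X * F X.
  move=> YB; rewrite [RHS]big_mkcond; apply: eq_bigr => X _.
  by case: ifPn => // XB; rewrite t_out // mul0r.
split.
- move=> x /K0spanP xB; apply/K0spanP => Z ZB; rewrite TE big1 // => X _.
  have [XB|XB] := boolP (X \in B); first by rewrite t_sym t_out // mul0r.
  by rewrite xB // mulr0.
- by move=> i j; rewrite ME.
- move=> [J1 [J2 [_ _ /set0Pn[i iJ1] /set0Pn[j jJ2] M0]]].
  have := t_gt0 _ _ (enum_valP i) (enum_valP j).
  by rewrite -ME (M0 i j iJ1 jJ2) ltxx.
(* The dimensions on [B] form a positive right eigenvector: in a row of [B], [t_eigen] involves only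
   columns of [B]. *)
- apply: (@spectral_radius_right _ _ _ (\row_i dimC R (enum_val i))).
  + by apply/card_gt0P; exists X0.
  + by move=> i j; rewrite ME.
  + by move=> i; rewrite mxE.
  apply/rowP => i; rewrite !mxE -t_eigen sum_supp ?enum_valP // -sumB.
  by apply: eq_bigr => j _; rewrite [X in _ * X]mxE ME mxE mulrC.
split.
  apply/eqP => /(congr1 (fun x : K0 C R => x X0)).
  by rewrite regular_onE X0B ffunE => /eqP; rewrite gt_eqF.
move=> x; split=> [[/K0spanP xB Tx]|/vlineP[c ->]].
  (* The maximum principle on the positive block makes [x] proportional to the dimensions on [B];
     off [B] both vectors vanish. *)
  have [|i|i|i|c xc] := @positive_eigenvector_unique _ _
    (fun i j : 'I_#|B| => t (enum_val i) (enum_val j))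
    (fun i => dimC R (enum_val i)) (fun i => x (enum_val i)) lambda%:C%C.
  - by move=> i j; apply: t_gt0; apply: enum_valP.
  - exact: d_gt0.
  - by rewrite (sumB (fun X => t (enum_val i) X * dimC R X)) -sum_supp ?enum_valP.
  - rewrite (sumB (fun X => t (enum_val i) X * x X)) -sum_supp ?enum_valP // -TE Tx.
    by rewrite ffunE.
  apply/vlineP; exists c; apply/ffunP => X; rewrite ffunE regular_onE.
  case: ifPn => [XB|XB]; last by rewrite xB // scaler0.
  by have := xc (enum_rank_in X0B X); rewrite enum_rankK_in.
have cE X : (c *: regular_on R B) X = c * if X \in B then dimC R X else 0.
  by rewrite ffunE regular_onE.
split; first by apply/K0spanP => Z ZB; rewrite cE (negPf ZB) mulr0.
apply/ffunP => Y; rewrite TE [RHS]ffunE cE.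
under eq_bigr do rewrite cE mulrCA.
rewrite -mulr_sumr /GRing.scale /= mulrCA; congr (_ * _).
(* On [B] this is [t_eigen]; off [B] each product vanishes, through [t] or through the coefficient
   of [R_B]. *)
have [YB|YB] := boolP (Y \in B).
  rewrite -t_eigen (sum_supp Y (dimC R)) // [LHS]sum_supp //.
  by apply: eq_bigr => X ->.
rewrite mulr0 big1 // => X _; case: ifPn => [XB|_]; last by rewrite mulr0.
by rewrite t_sym t_out // mul0r.
Qed.
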